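(* Let $\mathbf{X}\in\mathfrak{L}_{m,n}^{\beta}(n)$, let $\mathbf{A}\in\mathfrak{L}_{n,p}^{\beta}(n)$ be constant, and let $\mathbf{Y}\in\mathfrak{L}_{m,p}^{\beta}(n)$. If $\mathbf{Y}=\mathbf{A}\mathbf{X}$, then $$(d\mathbf{Y})=\prod_{i=1}^{n}\sigma_i(\mathbf{A})^{\beta m}\,(d\mathbf{X})=\prod_{i=1}^{n}\lambda_i(\mathbf{A}\mathbf{A}^{*})^{\beta m/2}\,(d\mathbf{X}),$$ where $\lambda_i(\mathbf{M})$ and $\sigma_i(\mathbf{M})$ are the $i$-th non-null eigenvalue and the $i$-th non-null singular value of $\mathbf{M}$, respectively.
   Context: $\mathfrak{F}$ is one of the four real normed division algebras: real numbers, complex numbers, quaternions or octonions, of real dimension $\beta=1,2,4,8$ respectively; $\mathbf{M}^{*}$ is the conjugate transpose. $\mathfrak{L}_{m,n}^{\beta}(q)$ is the set of all $n\times m$ matrices over $\mathfrak{F}$ of rank $q\le\min(n,m)$ with $q$ distinct (non-null) singular values (the first index is the number of columns, the second the number of rows). The volume element $(d\mathbf{X})$ on $\mathfrak{L}_{m,n}^{\beta}(q)$: after left and right multiplication by permutation matrices, one may take the leading $q\times q$ block $\mathbf{X}_{11}$ of $\mathbf{X}=\begin{pmatrix}\mathbf{X}_{11}&\mathbf{X}_{12}\\ \mathbf{X}_{21}&\mathbf{X}_{22}\end{pmatrix}$ to have rank $q$, and $(d\mathbf{X})$ denotes the exterior product of the differentials of the $(nq+mq-q^2)\beta$ mathematically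 independent real components of the entries, $(d\mathbf{X})\equiv(d\mathbf{X}_{11})\wedge(d\mathbf{X}_{12})\wedge(d\mathbf{X}_{21})$. It is taken to be invariant, $(d\mathbf{X})=(\mathbf{P}\,d\mathbf{X}\,\mathbf{Q})$, for all $\mathbf{P}\in\mathfrak{U}^{\beta}(n)$, $\mathbf{Q}\in\mathfrak{U}^{\beta}(m)$, where $\mathfrak{U}^{\beta}(m)$ is the group of $m\times m$ matrices $\mathbf{H}$ over $\mathfrak{F}$ with $\mathbf{H}^{*}\mathbf{H}=\mathbf{I}_m$. Formally it is the Hausdorff measure, which coincides with Lebesgue measure when the latter is defined on the subspace of $\mathfrak{F}^{n\times m}$ on which $\mathbf{X}$ lives. When $q=\min(n,m)$ is full rank and the matrix is unconstrained, $(d\mathbf{X})$ is Lebesgue measure on $\mathfrak{F}^{n\times m}$. *)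

(* Defs.v *)
From HB Require Import structures.
From mathcomp Require Import all_boot all_order all_algebra.
From mathcomp Require Import finmap.
From mathcomp Require Import all_classical all_reals all_analysis.

Set Implicit Arguments.
Unset Strict Implicit.
Unset Printing Implicit Defensive.

Import Order.TTheory GRing.Theory Num.Theory.
Import numFieldNormedType.Exports.

Local Open Scope classical_set_scope.
Local Open Scope ring_scope.

(* The Cayley-Dickson algebras over R: real dimension 2 ^ k, and for
   k = 0, 1, 2, 3 the reals, complex numbers, quaternions and octonions.
   The norm carried by this structure is the library's sup norm on products; it
   is used only for its topology.  Lengths are measured with cd_normsq. *)
Fixpoint cd (R : realType) (k : nat) : normedModType R :=
  match k with
  | 0 => R^o
  | k'.+1 => (cd R k' * cd R k')%type
  end.

Fixpoint cd_conj (R : realType) (k : nat) : cd R k -> cd R k :=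
  match k with
  | 0 => fun x => x
  | k'.+1 => fun x => (cd_conj x.1, - x.2)
  end.

Fixpoint cd_mul (R : realType) (k : nat) : cd R k -> cd R k -> cd R k :=
  match k with
  | 0 => fun x y : R => x * y
  | k'.+1 => fun x y =>
      (cd_mul x.1 y.1 - cd_mul (cd_conj y.2) x.2,
       cd_mul y.2 x.1 + cd_mul x.2 (cd_conj y.1))
  end.

Fixpoint cd_normsq (R : realType) (k : nat) : cd R k -> R :=
  match k with
  | 0 => fun x : R => x ^+ 2
  | k'.+1 => fun x => cd_normsq x.1 + cd_normsq x.2
  end.

Section Matrices.
Variables (R : realType) (k : nat).

(* cd R k has no ringType structure (it is not associative for k = 3), so the
   library's *m is not available. *)
Definition cd_mulmx (n m p : nat) (A : 'M[cd R k]_(n, m))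
    (B : 'M[cd R k]_(m, p)) : 'M[cd R k]_(n, p) :=
  \matrix_(i, j) \sum_(l < m) cd_mul (A i l) (B l j).

Definition cd_adj (n m : nat) (A : 'M[cd R k]_(n, m)) : 'M[cd R k]_(m, n) :=
  \matrix_(i, j) cd_conj (A j i).

Definition rscalemx (r : R) (n m : nat) (A : 'M[cd R k]_(n, m)) :
    'M[cd R k]_(n, m) :=
  map_mx ( *:%R r) A.

Definition cols_free (n m : nat) (A : 'M[cd R k]_(n, m)) (J : {set 'I_m}) :
    Prop :=
  forall c : 'cV[cd R k]_m,
    (forall j, j \notin J -> c j 0 = 0) -> cd_mulmx A c = 0 -> c = 0.

(* Maximal number of columns that are linearly independent on the right. *)
Definition cd_rank (n m : nat) (A : 'M[cd R k]_(n, m)) : nat :=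
  (\max_(J : {set 'I_m} | `[< cols_free A J >]) #|J|)%N.

Definition singular_values (n m : nat) (A : 'M[cd R k]_(n, m)) : set R :=
  [set s | 0 < s /\
     exists (u : 'cV[cd R k]_n) (v : 'cV[cd R k]_m),
       [/\ u != 0, v != 0, cd_mulmx A v = rscalemx s u
         & cd_mulmx (cd_adj A) u = rscalemx s v]].

(* Real eigenvalues only: for Hermitian matrices over R, C and H these are all
   the (right) eigenvalues. *)
Definition nonnull_eigenvalues (n : nat) (M : 'M[cd R k]_n) : set R :=
  [set l | l != 0 /\
     exists2 v : 'cV[cd R k]_n, v != 0 & cd_mulmx M v = rscalemx l v].

(* The i-th largest element (from i = 0) of a finite set of reals.  Values are
   not repeated according to multiplicity. *)
Definition ith_largest (S : set R) (i : nat) : R :=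
  nth 0 (sort >=%R (enum_fset (fset_set S))) i.

Definition sigma (n m : nat) (A : 'M[cd R k]_(n, m)) (i : nat) : R :=
  ith_largest (singular_values A) i.

Definition lambda (n : nat) (M : 'M[cd R k]_n) (i : nat) : R :=
  ith_largest (nonnull_eigenvalues M) i.

(* n x m matrices: the first index is the number of columns. *)
Definition frakL (m n q : nat) : set 'M[cd R k]_(n, m) :=
  [set X | cd_rank X = q /\ (singular_values X #= `I_q)%card].

Definition mxdist (n m : nat) (X Y : 'M[cd R k]_(n, m)) : R :=
  Num.sqrt (\sum_(i < n) \sum_(j < m) cd_normsq ((X - Y) i j)).

Definition borel (n m : nat) : set (set 'M[cd R k]_(n, m)) :=
  <<s [set U : set 'M[cd R k]_(n, m) | open U] >>.

End Matrices.

Arguments frakL {R k} m n q _.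

Section Hausdorff.
Variables (R : realType) (T : Type) (dist : T -> T -> R).

Local Open Scope ereal_scope.

(* Volume of the unit ball of R^d. *)
Fixpoint unit_ball_volume (d : nat) : R :=
  match d with
  | 0 => 1%R
  | 1 => 2%R
  | d'.+2 => (2 * pi / d%:R * unit_ball_volume d')%R
  end.

Definition diam (U : set T) : \bar R :=
  ereal_sup [set (dist x y)%:E | x in U & y in U].

Definition hausdorff_term (d : nat) (U : set T) : \bar R :=
  if `[< U = set0 >] then 0
  else (unit_ball_volume d / 2 ^+ d)%:E * diam U ^+ d.

Definition hausdorff_pre (d : nat) (delta : R) (E : set T) : \bar R :=
  ereal_inf [set \sum_(0 <= i <oo) hausdorff_term d (U i) |
    U in [set U : nat -> set T |
      E `<=` \bigcup_i U i /\ forall i, diam (U i) <= delta%:E]].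

Definition hausdorff (d : nat) (E : set T) : \bar R :=
  ereal_sup [set hausdorff_pre d delta E | delta in [set delta : R | (0 < delta)%R]].

End Hausdorff.

(* The d-dimensional volume on n x m matrices, as a Hausdorff measure normalized
   so as to agree with d-dimensional Lebesgue measure on d-dimensional real
   subspaces; for d = n * m * 2 ^ k it is Lebesgue measure on all matrices. *)
Definition vol (R : realType) (k n m d : nat) (E : set 'M[cd R k]_(n, m)) :
    \bar R :=
  hausdorff (@mxdist R k n m) d E.

(* Main.v *)
Require Import Defs.
From HB Require Import structures.
From mathcomp Require Import all_boot all_order all_algebra.
From mathcomp Require Import finmap complex spectral.
From mathcomp Require Import all_classical all_reals all_analysis.
From mathcomp Require Import measurable_realfun ring lra.

(* When k <= 2, or when n <= 1, singular vectors of A give matrices U and V such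
   that A (V Z) = U (S Z), where S scales the rows by the singular values and
   Z |-> U Z and Z |-> V Z are isometries.  Since Hausdorff measure is invariant
   under isometries, only the effect of S on it has to be computed.  In real
   coordinates, top-dimensional Hausdorff measure is a translation invariant
   Borel measure that is finite on boxes, hence additive and therefore linear in
   each side of a box; two such measures that agree on boxes are equal.  The
   normalization of the measure plays no role.

   For octonions and n >= 2 the real multiplicities of the n distinct singular
   values of A are not forced to be 8, but then E is a null set: the real
   symmetric operator u |-> X (X^* u) has at most n + 1 eigenvalues, so its powers
   up to n + 1 are linearly dependent, which makes X a zero of a polynomial.  This
   polynomial does not vanish at an explicit matrix whose operator has n + 2
   eigenvalues.  Its zero set is null because each point lies in only finitely
   many of the dilates of that set about this matrix. *)

Set Implicit Arguments.
Unset Strict Implicit.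
Unset Printing Implicit Defensive.

Import Order.TTheory GRing.Theory Num.Theory.
Import numFieldNormedType.Exports.

Local Open Scope classical_set_scope.
Local Open Scope ring_scope.

(** * Hausdorff measure *)

(** Two products of columns have to be kept apart. For the real inner product, multiplication by
    [cd_adj A] is adjoint to multiplication by [A] at every level, but real orthogonality of two
    columns is in general lost when they are multiplied by scalars. Vanishing of the [F]-valued
    product survives such multiplication, but this and the adjoint relation of that product rest on
    associativity. The isometries [U] and [V] need the second kind of orthogonality, which is the
    source of the bound [k <= 2]. With at most one column there is no orthogonality to establish,
    and the composition law, valid up to the octonions, is enough.

    The image of [E] consists of [p] x [m] matrices, where [d] may be smaller than the full real
    dimension. The factorization moves the scaling back to [n] x [m] matrices, where [d] is the top
    dimension and Hausdorff measure can be computed on boxes.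

    In the octonion case with [n >= 2] the equalities read [0 = 0]: multiplication by [A] is
    Lipschitz, so the image of the null set [E] is null as well. *)

Lemma unit_ball_volume_gt0 (R : realType) (d : nat) :
  0 < unit_ball_volume R d.
Proof.
have H e : 0 < unit_ball_volume R e /\ 0 < unit_ball_volume R e.+1.
  elim: e => [|e [IH1 IH2]]; first by split.
  by split=> //=; rewrite !mulr_gt0 ?invr_gt0 ?pi_gt0.
by have [] := H d.
Qed.

Lemma lee_expe2r (R : realDomainType) (n : nat) (x y : \bar R) :
  (0 <= x -> x <= y -> x ^+ n <= y ^+ n)%E.
Proof.
move=> x0 xy; elim: n => // n IH; rewrite !expeS lee_pmul//.
exact: expe_ge0.
Qed.

Section hausdorff_outer_measure.
Local Open Scope ereal_scope.
Context (R : realType) (T : Type) (dist : T -> T -> R).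
Hypothesis dist_ge0 : forall x y, (0 <= dist x y)%R.

Lemma diam_ge0 (U : set T) : U !=set0 -> 0 <= diam dist U.
Proof.
move=> [x Ux]; apply: (@le_trans _ _ (dist x x)%:E); first by rewrite lee_fin.
by apply: ereal_sup_ubound; exists x => //; exists x.
Qed.

Lemma le_diam (U V : set T) : U `<=` V -> diam dist U <= diam dist V.
Proof.
move=> UV; apply: ereal_sup_le => _ [x Ux [y Uy <-]].
by exists x; [exact: UV|exists y => //; exact: UV].
Qed.

Lemma hausdorff_term_set0 d : hausdorff_term dist d set0 = 0.
Proof. by rewrite /hausdorff_term asboolT. Qed.

Lemma hausdorff_termN0 d (U : set T) : U !=set0 ->
  hausdorff_term dist d U =
  (unit_ball_volume R d / 2 ^+ d)%:E * diam dist U ^+ d.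
Proof. by move=> /set0P/eqP U0; rewrite /hausdorff_term asboolF. Qed.

Let coef_ge0 d : (0 <= unit_ball_volume R d / 2 ^+ d)%R.
Proof. by rewrite divr_ge0// ltW// unit_ball_volume_gt0. Qed.

Lemma hausdorff_term_ge0 d (U : set T) : 0 <= hausdorff_term dist d U.
Proof.
have [->|/set0P U0] := eqVneq U set0; first by rewrite hausdorff_term_set0.
by rewrite hausdorff_termN0// mule_ge0 ?lee_fin// expe_ge0// diam_ge0.
Qed.

Lemma le_hausdorff_term d (U V : set T) : U `<=` V ->
  hausdorff_term dist d U <= hausdorff_term dist d V.
Proof.
move=> UV; have [->|/set0P U0] := eqVneq U set0.
  by rewrite hausdorff_term_set0 hausdorff_term_ge0.
have V0 : V !=set0 by case: U0 => x /UV; exists x.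
rewrite !hausdorff_termN0// lee_pmul ?lee_fin//.
  by rewrite expe_ge0// diam_ge0.
by apply: lee_expe2r; rewrite ?diam_ge0// le_diam.
Qed.

Lemma hausdorff_pre_ge0 d delta (E : set T) : 0 <= hausdorff_pre dist d delta E.
Proof.
apply: le_ereal_inf_tmp => _ [U _ <-]; apply: nneseries_ge0 => i _ _.
exact: hausdorff_term_ge0.
Qed.

Lemma hausdorff_ge0 d (E : set T) : 0 <= hausdorff dist d E.
Proof.
apply: (@le_trans _ _ (hausdorff_pre dist d 1 E)).
  exact: hausdorff_pre_ge0.
by apply: ereal_sup_ubound; exists 1%R => //=.
Qed.

Lemma le_hausdorff_pre_hausdorff d (delta : R) E : (0 < delta)%R ->
  hausdorff_pre dist d delta E <= hausdorff dist d E.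
Proof. by move=> d0; apply: ereal_sup_ubound; exists delta. Qed.

Lemma le_hausdorff_pre d (delta : R) (E F : set T) : E `<=` F ->
  hausdorff_pre dist d delta E <= hausdorff_pre dist d delta F.
Proof.
move=> EF; apply: ereal_inf_le_tmp => _ [U [FU dU] <-].
by exists U => //; split => //; exact: subset_trans FU.
Qed.

Lemma hausdorff_pre_anti d (delta delta' : R) (E : set T) :
  (delta <= delta')%R ->
  hausdorff_pre dist d delta' E <= hausdorff_pre dist d delta E.
Proof.
move=> dd'; apply: ereal_inf_le_tmp => _ [U [FU dU] <-].
exists U => //; split => // i; apply: le_trans (dU i) _.
by rewrite lee_fin.
Qed.

Lemma hausdorff_set0 d : hausdorff dist d set0 = 0.
Proof.
apply/eqP; rewrite eq_le hausdorff_ge0 andbT.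
apply: ge_ereal_sup => _ [delta d0 <-].
apply: ereal_inf_lbound; exists (fun=> set0).
  split=> [//|i]; rewrite /diam.
  rewrite (_ : [set _ | x in _ & y in _] = set0) ?ereal_sup0 ?leNye//.
  by apply/seteqP; split=> // x [].
by rewrite eseries0// => i _ _; rewrite hausdorff_term_set0.
Qed.

Lemma le_hausdorff d (E F : set T) : E `<=` F ->
  hausdorff dist d E <= hausdorff dist d F.
Proof.
move=> EF; apply: ge_ereal_sup => _ [delta d0 <-].
apply: le_trans (le_hausdorff_pre_hausdorff d F d0).
exact: le_hausdorff_pre.
Qed.

(* A set of diameter less than the gap between A and B meets at most one of
   them, so a fine enough cover of the union splits into two covers. *)
Lemma hausdorff_separated d (A B : set T) (eta : R) : (0 < eta)%R ->
  (forall x y, A x -> B y -> (eta <= dist x y)%R) ->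
  hausdorff dist d A + hausdorff dist d B <= hausdorff dist d (A `|` B).
Proof.
move=> eta0 sep.
have pre (delta : R) : (0 < delta < eta)%R -> hausdorff_pre dist d delta A +
    hausdorff_pre dist d delta B <= hausdorff_pre dist d delta (A `|` B).
  move=> /andP[delta0 deta]; apply: le_ereal_inf_tmp => _ [U [ABU dU] <-].
  have dUI C i : diam dist (U i `&` C) <= delta%:E.
    by apply: le_trans (dU i); apply: le_diam => ? [].
  apply: (@le_trans _ _ (\sum_(0 <= i <oo) hausdorff_term dist d (U i `&` A) +
      \sum_(0 <= i <oo) hausdorff_term dist d (U i `&` B))).
    apply: leeD; apply: ereal_inf_lbound.
      exists (fun i => U i `&` A) => //; split=> // x Ax.
      by have [i _ Ui] := ABU x (or_introl Ax); exists i.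
    exists (fun i => U i `&` B) => //; split=> // x Bx.
    by have [i _ Ui] := ABU x (or_intror Bx); exists i.
  rewrite -nneseriesD; try by move=> *; exact: hausdorff_term_ge0.
  apply: lee_nneseries => [i _ _|i _].
    by apply: adde_ge0; exact: hausdorff_term_ge0.
  have [UA|/set0P[x [Ux Ax]]] := eqVneq (U i `&` A) set0.
    by rewrite UA hausdorff_term_set0 add0e; apply: le_hausdorff_term => ? [].
  have [UB|/set0P[y [Uy By]]] := eqVneq (U i `&` B) set0.
    by rewrite UB hausdorff_term_set0 adde0; apply: le_hausdorff_term => ? [].
  have : (dist x y)%:E <= delta%:E.
    by apply: le_trans (dU i); apply: ereal_sup_ubound; exists x => //; exists y.
  by rewrite lee_fin leNgt (lt_le_trans deta)// sep.
have [->|Aoo] := eqVneq (hausdorff dist d (A `|` B)) +oo; first exact: leey.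
have leA : hausdorff dist d A <= hausdorff dist d (A `|` B).
  by apply: le_hausdorff; exact: subsetUl.
have leB : hausdorff dist d B <= hausdorff dist d (A `|` B).
  by apply: le_hausdorff; exact: subsetUr.
have fU : hausdorff dist d (A `|` B) \is a fin_num.
  by rewrite ge0_fin_numE ?hausdorff_ge0// ltey.
have fA : hausdorff dist d A \is a fin_num.
  by rewrite ge0_fin_numE ?hausdorff_ge0// (le_lt_trans leA)// ltey.
rewrite -leeBrDl//.
apply: ge_ereal_sup => _ [delta2 d20 <-]; rewrite leeBrDl// addeC -leeBrDl; last first.
  rewrite ge0_fin_numE ?hausdorff_pre_ge0//.
  apply: le_lt_trans (le_hausdorff_pre_hausdorff d B d20) _.
  by rewrite (le_lt_trans leB)// ltey.
apply: ge_ereal_sup => _ [delta1 d10 <-]; rewrite leeBrDl; last first.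
  rewrite ge0_fin_numE ?hausdorff_pre_ge0//.
  apply: le_lt_trans (le_hausdorff_pre_hausdorff d B d20) _.
  by rewrite (le_lt_trans leB)// ltey.
(* The two suprema were opened at their own scales. Since [hausdorff_pre] grows as the scale
   shrinks, they are compared at a common one, taken below [eta] so that [pre] applies. *)
pose delta := (Num.min (Num.min delta1 delta2) (eta / 2))%R.
have delta0 : (0 < delta)%R by rewrite !lt_min/= d10 d20 divr_gt0.
have := pre delta; rewrite delta0/= gt_min ltr_pdivrMr// ltr_pMr// ltr1n orbT.
move=> /(_ isT); rewrite addeC => h.
apply: le_trans (leeD _ _) (le_trans h _).
- by apply: hausdorff_pre_anti; rewrite !ge_min lexx !orbT.
- by apply: hausdorff_pre_anti; rewrite !ge_min lexx.
- exact: le_hausdorff_pre_hausdorff.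
Qed.

End hausdorff_outer_measure.

Section hausdorff_subadditive.
Local Open Scope ereal_scope.
Context (R : realType) (T : pointedType) (dist : T -> T -> R).
Hypothesis dist_ge0 : forall x y, (0 <= dist x y)%R.

(** The bound on diameters is moved from the covers into the cost: a set that is too large costs
    [+oo]. This presents [hausdorff_pre] as the outer measure induced by a set function, which is
    sigma-subadditive. *)
Let gated_term d (delta : R) (U : set T) :=
  if diam dist U <= delta%:E then hausdorff_term dist d U else +oo.

Let gated_term_ge0 d delta U : 0 <= gated_term d delta U.
Proof. by rewrite /gated_term; case: ifP => _ //; exact: hausdorff_term_ge0. Qed.

(** The sigma-algebra generated by all sets makes every cover measurable, so that [mu_ext] ranges
    over arbitrary covers. *)
Let hausdorff_pre_mu_ext d (delta : R) (E : set T) : hausdorff_pre dist d delta E =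
  @mu_ext _ (g_sigma_algebraType [set: set T]) R (gated_term d delta) E.
Proof.
apply/eqP; rewrite eq_le; apply/andP; split; last first.
  apply: ereal_inf_le_tmp => _ [U [FU dU] <-].
  exists U; first by split=> // i; exact: sub_sigma_algebra.
  by apply: eq_eseriesr => i _; rewrite /gated_term dU.
apply: le_ereal_inf_tmp => _ [U [_ EU] <-].
have [dU|] := pselect (forall i, diam dist (U i) <= delta%:E).
  apply: ereal_inf_lbound; exists U => //.
  by apply: eq_eseriesr => i _; rewrite /gated_term dU.
move=> /existsNP[i /negP dU]; rewrite (@eseries_pinfty _ _ _ i) ?leey//.
  by move=> n _; rewrite gt_eqF// (lt_le_trans _ (gated_term_ge0 _ _ _)).
by rewrite /gated_term (negbTE dU).
Qed.

Lemma hausdorff_pre_sigma_subadditive d (delta : R) :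
  sigma_subadditive (hausdorff_pre dist d delta).
Proof.
move=> F; rewrite hausdorff_pre_mu_ext; under eq_eseriesr do rewrite hausdorff_pre_mu_ext.
exact: mu_ext_sigma_subadditive.
Qed.

Lemma hausdorff_sigma_subadditive d : sigma_subadditive (hausdorff dist d).
Proof.
move=> F; apply: ge_ereal_sup => _ [delta d0 <-].
apply: le_trans (hausdorff_pre_sigma_subadditive _ _ _) _.
apply: lee_nneseries => i _; first by move=> *; exact: hausdorff_pre_ge0.
exact: le_hausdorff_pre_hausdorff.
Qed.

End hausdorff_subadditive.

Lemma diam_image_le (R : realType) (T T' : Type) (dist : T -> T -> R)
    (dist' : T' -> T' -> R) (f : T -> T') (U : set T) (L : R) : 0 <= L ->
  (forall x y, U x -> U y -> dist' (f x) (f y) <= L * dist x y) ->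
  U !=set0 -> (diam dist' (f @` U) <= L%:E * diam dist U)%E.
Proof.
move=> L0 fL U0; apply: ge_ereal_sup => _ [_ [x Ux <-] [_ [y Uy <-] <-]].
apply: (@le_trans _ _ (L * dist x y)%:E); first by rewrite lee_fin fL.
rewrite EFinM lee_wpmul2l ?lee_fin//.
by apply: ereal_sup_ubound; exists x => //; exists y.
Qed.

Lemma expeM (R : realDomainType) (n : nat) (x y : \bar R) :
  ((x * y) ^+ n = x ^+ n * y ^+ n)%E.
Proof. by elim: n => [|n IH]; rewrite ?mule1// !expeS IH muleACA. Qed.

Section hausdorff_lipschitz.
Context (R : realType) (T T' : Type).
Variables (dist : T -> T -> R) (dist' : T' -> T' -> R).
Hypothesis dist_ge0 : forall x y, 0 <= dist x y.
Hypothesis dist'_ge0 : forall x y, 0 <= dist' x y.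

Lemma hausdorff_lipschitz (f : T -> T') (E : set T) (L : R) (d : nat) : 0 < L ->
  (forall x y, E x -> E y -> dist' (f x) (f y) <= L * dist x y) ->
  (hausdorff dist' d (f @` E) <= (L ^+ d)%:E * hausdorff dist d E)%E.
Proof.
move=> L0 fL; apply: ge_ereal_sup => _ [delta delta0 <-].
apply: (@le_trans _ _ ((L ^+ d)%:E * hausdorff_pre dist d (delta / L) E))%E; last first.
  rewrite lee_wpmul2l ?lee_fin ?exprn_ge0 ?(ltW L0)//.
  by apply: le_hausdorff_pre_hausdorff => /=; rewrite divr_gt0.
rewrite -ereal_inf_pZl ?exprn_gt0//.
apply: le_ereal_inf_tmp => _ [_ [U [EU dU] <-] <-].
have fLU i x y : (U i `&` E) x -> (U i `&` E) y -> dist' (f x) (f y) <= L * dist x y.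
  by move=> [_ Ex] [_ Ey]; exact: fL.
(* The bound on [f] is known only on [E], so the members of the cover are cut down to [E] before
   taking images. *)
apply: ge_ereal_inf;
  exists (\sum_(0 <= i <oo) hausdorff_term dist' d (f @` (U i `&` E)))%E.
  exists (fun i => f @` (U i `&` E)) => //; split=> [_ [x Ex <-]|i].
    by have [i _ Ui] := EU x Ex; exists i => //; exists x.
  (* The diameter of the empty set is [-oo], so empty pieces are treated apart. *)
  have [->|/set0P UE] := eqVneq (U i `&` E) set0.
    rewrite image_set0 /diam (_ : [set _ | x in _ & y in _] = set0) ?ereal_sup0 ?leNye//.
    by apply/seteqP; split=> // x [].
  apply: le_trans (diam_image_le (ltW L0) (fLU i) UE) _.
  apply: (@le_trans _ _ (L%:E * (delta / L)%:E)%E).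
    rewrite lee_wpmul2l ?lee_fin ?(ltW L0)//; apply: le_trans (dU i).
    by apply: le_diam => ? [].
  by rewrite -EFinM mulrC divfK ?gt_eqF.
rewrite -nneseriesZl//; last by move=> *; exact: hausdorff_term_ge0.
apply: lee_nneseries => [i _ _|i _]; first exact: hausdorff_term_ge0.
have [->|/set0P UE] := eqVneq (U i `&` E) set0.
  by rewrite image_set0 hausdorff_term_set0 mule_ge0 ?lee_fin ?exprn_ge0 ?(ltW L0)//
     hausdorff_term_ge0.
have fUE : f @` (U i `&` E) !=set0 by case: UE => x UEx; exists (f x), x.
have Ui0 : U i !=set0 by case: UE => x [Ux _]; exists x.
rewrite !hausdorff_termN0// muleCA lee_wpmul2l//.
  by rewrite lee_fin divr_ge0// ltW// unit_ball_volume_gt0.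
rewrite EFin_expe -expeM.
apply: lee_expe2r; first exact: diam_ge0.
apply: le_trans (diam_image_le (ltW L0) (fLU i) UE) _.
rewrite lee_wpmul2l ?lee_fin ?(ltW L0)//.
by apply: le_diam => ? [].
Qed.

End hausdorff_lipschitz.

(** Two Lipschitz bounds with constant [1]: one for [f], one for an inverse chosen on the image. *)
Lemma hausdorff_isometry (R : realType) (T T' : Type) (dist : T -> T -> R)
    (dist' : T' -> T' -> R) (f : T -> T') (E : set T) (d : nat) :
  (forall x y, 0 <= dist x y) -> (forall x y, 0 <= dist' x y) -> injective f ->
  (forall x y, E x -> E y -> dist' (f x) (f y) = dist x y) ->
  hausdorff dist' d (f @` E) = hausdorff dist d E.
Proof.
move=> d0 d'0 finj fE; apply/eqP; rewrite eq_le; apply/andP; split.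
  have := @hausdorff_lipschitz _ _ _ dist dist' d0 d'0 f E 1 d ltr01.
  rewrite expr1n mul1e; apply => x y Ex Ey; rewrite mul1r.
  by rewrite fE.
have [->|/set0P[x0 Ex0]] := eqVneq E set0; first by rewrite image_set0 !hausdorff_set0.
have /choice[g gP] : forall y, exists x, (f @` E) y -> E x /\ f x = y.
  move=> y; have [[x Ex <-]|nEy] := pselect ((f @` E) y); first by exists x.
  by exists x0.
have := @hausdorff_lipschitz _ _ _ dist' dist d'0 d0 g (f @` E) 1 d ltr01.
rewrite expr1n mul1e.
rewrite (_ : g @` (f @` E) = E); last first.
  apply/seteqP; split=> [_ [_ [x Ex <-] <-]|x Ex].
    by have [] := gP (f x) (imageP f Ex).
  exists (f x); first exact: imageP.
  by have [_ /finj] := gP (f x) (imageP f Ex).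
apply => x y /gP[Ex fx] /gP[Ey fy]; rewrite mul1r.
by rewrite -fE// fx fy.
Qed.

(** * Caratheodory measurability from metric separation *)

Section caratheodory_sublevel.
Local Open Scope ereal_scope.
Context (R : realType) (T : Type) (mu : {outer_measure set T -> \bar R}).
Variable g : T -> R.
Hypothesis mu_separated : forall (A B : set T) (eta : R), (0 < eta)%R ->
  (forall x y, A x -> B y -> (g x + eta <= g y)%R) -> mu A + mu B <= mu (A `|` B).

(* The annuli [r l] are separated from the second next inner set, so their
   measures telescope and the measure of a tail of them tends to 0. *)
Lemma caratheodory_sublevel : mu.-caratheodory [set x | (g x < 0)%R].
Proof.
apply: le_caratheodory_measurable => X; set S := [set x | _].
have [->|Xoo] := eqVneq (mu X) +oo; first exact: leey.
have fX A : A `<=` X -> mu A \is a fin_num.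
  move=> AX; rewrite ge0_fin_numE ?outer_measure_ge0//.
  by rewrite (le_lt_trans (le_outer_measure mu _ _ AX))// ltey.
pose e (j : nat) : R := (j.+1%:R^-1)%R.
have e0 j : (0 < e j)%R by rewrite invr_gt0.
have eS i j : (i < j)%N -> (e j < e i)%R.
  by move=> ij; rewrite ltf_pV2 ?posrE ?ltr0n// ltr_nat ltnS.
pose a j := X `&` [set x | (g x <= - e j)%R].
pose r j := X `&` [set x | (- e j < g x <= - e j.+1)%R].
pose f j := fine (mu (a j)).
have aX j : a j `<=` X by move=> x [].
have rX j : r j `<=` X by move=> x [].
have fE j : (f j)%:E = mu (a j) by rewrite fineK// fX.
have fr j : (f j + fine (mu (r j.+1)) <= f j.+2)%R.
  rewrite -lee_fin EFinD !fineK ?fX//.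
  apply: le_trans (@mu_separated _ _ (e j - e j.+1)%R _ _) _.
  - by rewrite subr_gt0 eS.
  - by move=> x y [_ /= ax] [_ /= /andP[ry _]]; lra.
  - apply: le_outer_measure => x [[Xx /= ax]|[Xx /= /andP[_ ry]]]; split=> //=.
    by have := @eS j j.+2 (leqnSn _); lra.
have fmono i j : (i <= j)%N -> (f i <= f j)%R.
  move=> ij; rewrite -lee_fin !fE; apply: le_outer_measure => x [Xx /= ax].
  split => //=; move: ij; rewrite leq_eqVlt => /predU1P[<-//|/eS]; lra.
have fub : has_sup (range f).
  split; first by exists (f 0%N), 0%N.
  exists (fine (mu X)) => _ [j _ <-]; rewrite -lee_fin fE fineK ?fX//.
  exact: le_outer_measure.
have fL j : (f j <= sup (range f))%R by apply: sup_upper_bound => //; exists j.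
set L := sup (range f) in fL.
have telescope j N : (\sum_(0 <= l < N) fine (mu (r (j + l).+1)) <=
    f (j + N).+1 + f (j + N)%N - f j.+1 - f j)%R.
  elim: N => [|N IH]; first by rewrite big_geq// addn0; lra.
  rewrite big_nat_recr//= addnS.
  by have := fr (j + N)%N; lra.
(* What [a j.+1] misses is a tail of annuli, whose total measure telescopes. As [f j] approaches [L]
   the bound becomes [L], so the inner sets exhaust the sublevel set in measure, which an outer
   measure does not grant by itself. *)
have le2 j : mu (X `&` S) <= (2 * L - f j)%:E.
  have -> : X `&` S = a j.+1 `|` \bigcup_l r (j + l).+1.
    apply/seteqP; split=> [x [Xx /= gx]|x]; last first.
      move=> [[Xx /= ax]|[l _ [Xx /= /andP[_ rx]]]]; split=> //.
        by rewrite /S/=; have := e0 j.+1; lra.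
      by rewrite /S/=; have := e0 (j + l).+2; lra.
    have [ax|ax] := leP (g x) (- e j.+1)%R; [by left|right].
    have [N] : exists N, (g x <= - e N)%R.
      have [N /= eN] := ltr_add_invr (y:=g x) (x:=0%R) gx.
      by exists N; have : (g x + e N < 0)%R := eN; lra.
    elim: N => [|N IH] gN; first by have := @eS 0%N j.+1 isT; lra.
    have [/IH//|gN'] := leP (g x) (- e N)%R.
    exists (N - j.+1)%N => //; split => //=.
    have jN : (j < N)%N.
      rewrite ltnNge; apply/negP => Nj.
      have : (e j.+1 <= e N.+1)%R.
        by move: Nj; rewrite leq_eqVlt => /predU1P[->//|Nj]; rewrite ltW// eS.
      by lra.
    by rewrite -addSn subnKC// gN' gN.
  apply: le_trans (outer_measureU2 _ _ _) _.
  have -> : (2 * L - f j = f j.+1 + (2 * L - f j - f j.+1))%R by lra.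
  rewrite EFinD -fE leeD2l//.
  apply: le_trans (outer_measure_sigma_subadditive mu _) _.
  apply: lime_le; first by apply: is_cvg_nneseries => *; exact: outer_measure_ge0.
  apply: nearW => N.
  have -> : \sum_(0 <= l < N) mu (r (j + l).+1) =
      (\sum_(0 <= l < N) fine (mu (r (j + l).+1)))%:E.
    by rewrite -sumEFin; apply: eq_bigr => l _; rewrite fineK// fX.
  rewrite lee_fin; have := telescope j N.
  by have := fL (j + N)%N; have := fL (j + N).+1; lra.
have leXS : mu (X `&` S) <= L%:E.
  apply/lee_addgt0Pr => eps eps0.
  have [_ [j _ <-] Lj] := sup_adherent eps0 fub.
  apply: le_trans (le2 j) _; rewrite -EFinD lee_fin.
  by rewrite -/L in Lj; lra.
apply: le_trans (leeD2r _ leXS) _.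
have fB : mu (X `&` ~` S) \is a fin_num by apply: fX => x [].
rewrite -(fineK fB) -EFinD -(fineK (fX X _))// lee_fin -lerBrDr.
apply: ge_sup; first exact: fub.1.
(* On [a j] the function [g] is at most [- e j], off [S] it is nonnegative: the two parts are
   separated by [e j]. *)
move=> _ [j _ <-]; rewrite lerBrDr -lee_fin EFinD !fineK ?fX//.
apply: le_trans (@mu_separated _ _ (e j) _ _) _ => //.
- by move=> x y [_ /= ax] [_ /= /negP]; rewrite -leNgt => ry; lra.
- by apply: le_outer_measure => x [|] [].
Qed.

End caratheodory_sublevel.

(** * Hausdorff measure of top dimension in real coordinates *)

Section euclidean.
Context (R : realType) (I : finType).

Definition coords : Type := I -> R.

HB.instance Definition _ := isPointed.Build coords (fun=> 0).

Definition euclid (x y : coords) : R := Num.sqrt (\sum_i (x i - y i) ^+ 2).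

Lemma euclid_ge0 x y : 0 <= euclid x y.
Proof. exact: sqrtr_ge0. Qed.

Lemma euclid_coord x y i : y i - x i <= euclid x y.
Proof.
apply: le_trans (ler_norm _) _; rewrite distrC -sqrtr_sqr; apply: ler_wsqrtr.
by rewrite (bigD1 i)//= lerDl sumr_ge0// => j _; exact: sqr_ge0.
Qed.

Lemma euclid_le x y c : 0 <= c -> (forall i, `|x i - y i| <= c) ->
  euclid x y <= Num.sqrt #|I|%:R * c.
Proof.
move=> c0 xyc; rewrite -[c in leRHS](ger0_norm c0) -sqrtr_sqr -sqrtrM ?ler0n//.
apply: ler_wsqrtr; rewrite mulr_natl -sumr_const; apply: ler_sum => i _.
by rewrite -real_normK ?num_real// lerXn2r// nnegrE.
Qed.

Definition hmeas : set coords -> \bar R := hausdorff euclid #|I|.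

HB.instance Definition _ := isOuterMeasure.Build R coords hmeas
  (hausdorff_set0 euclid_ge0 #|I|) (hausdorff_ge0 euclid_ge0 #|I|)
  (fun A B => @le_hausdorff R coords euclid #|I| A B)
  (hausdorff_sigma_subadditive euclid_ge0 #|I|).

(** Half-open, so that a half-space [x i < s] cuts a box into two disjoint boxes and intersections
    of boxes are boxes. *)
Definition box (a b : coords) : set coords := [set x | forall i, a i <= x i < b i].

Definition boxes : set (set coords) := [set box ab.1 ab.2 | ab in [set: coords * coords]].

Definition bcoords := g_sigma_algebraType boxes.

HB.instance Definition _ := Measurable.on bcoords.

Lemma measurable_box a b : measurable (box a b : set bcoords).
Proof. by apply: sub_sigma_algebra; exists (a, b). Qed.

(** A gap between two sets in one coordinate is a gap in Euclidean distance. *)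
Lemma hmeas_halfspace i c : hmeas.-caratheodory [set x | x i < c].
Proof.
have -> : [set x : coords | x i < c] = [set x | (fun x : coords => x i - c) x < 0].
  by apply/seteqP; split => x /=; rewrite subr_lt0.
apply: caratheodory_sublevel => A B eta eta0 sep.
refine (hausdorff_separated euclid_ge0 _ eta0 _) => x y Ax By.
by have := sep x y Ax By; have := euclid_coord x y i; lra.
Qed.

Lemma hmeas_measurable (E : set coords) : measurable (E : set bcoords) ->
  hmeas.-caratheodory E.
Proof.
apply: smallest_sub.
  split.
  - exact: caratheodory_measurable_set0.
  - by move=> A mA; rewrite setTD; exact: caratheodory_measurable_setC.
  - by move=> F mF; exact: caratheodory_measurable_bigcup.
move=> _ [[a b] _ <-] /=.
have -> : box a b =
    \bigcap_(i in [set: I]) ([set x | x i < b i] `&` ~` [set x | x i < a i]).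
  apply/seteqP; split=> [x xab i _|x xab i].
    by have /andP[xa xb] := xab i; split=> //=; apply/negP; rewrite -leNgt.
  by have [/= xb /negP] := xab i Logic.I; rewrite -leNgt => ->.
have mH i c : measurable ([set x | x i < c] : set (caratheodory_type hmeas)).
  exact: hmeas_halfspace.
suff : measurable (\bigcap_(i in [set: I]) ([set x | x i < b i] `&`
  ~` [set x | x i < a i]) : set (caratheodory_type hmeas)) by [].
apply: fin_bigcap_measurable => [|i _]; first exact: finite_finset.
by apply: measurableI => //; exact: measurableC.
Qed.

Definition bmeas : set bcoords -> \bar R := hmeas.

Let bmeas0 : bmeas set0 = 0%E. Proof. exact: outer_measure0. Qed.
Let bmeas_ge0 A : (0 <= bmeas A)%E. Proof. exact: outer_measure_ge0. Qed.
Let bmeas_sigma_additive : semi_sigma_additive bmeas.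
Proof.
move=> F mF tF mUF.
apply: (@caratheodory_measure_sigma_additive R coords hmeas F) => //.
  by move=> i; exact: hmeas_measurable.
exact: hmeas_measurable.
Qed.

HB.instance Definition _ := isMeasure.Build _ _ _ bmeas
  bmeas0 bmeas_ge0 bmeas_sigma_additive.

Lemma measurable_coord i : measurable_fun [set: bcoords] (fun x : bcoords => x i).
Proof.
apply: (measurability _ (RGenInftyO.measurableE R)) => _ [_ [c ->] <-].
rewrite setTI.
have -> : (fun x : bcoords => x i) @^-1` `]-oo, c[ = \bigcup_n
    box (fun=> - n%:R) (fun j => if j == i then c else n%:R).
  apply/seteqP; split=> [x|x [n _ xn]]; rewrite /= in_itv/=; last first.
    by have := xn i; rewrite eqxx => /andP[].
  move=> xc; exists (Num.bound (\sum_j `|x j|)) => // j.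
  have := @archi_boundP R (\sum_j `|x j|) (sumr_ge0 _ (fun j _ => normr_ge0 _)).
  set n := (Num.bound _)%:R => xn.
  have : `|x j| < n.
    apply: le_lt_trans xn; rewrite (bigD1 j)//= lerDl.
    by apply: sumr_ge0 => l _; exact: normr_ge0.
  rewrite ltr_norml => /andP[xn1 xn2]; rewrite ltW//=.
  by case: eqP => [->|].
by apply: bigcup_measurable => n _; exact: measurable_box.
Qed.

Lemma measurable_fun_coords d (T : measurableType d) (D : set T) (f : T -> bcoords) :
  (forall i, measurable_fun D (fun x => f x i)) -> measurable_fun D f.
Proof.
move=> mf mD; apply: (@measurability _ _ T bcoords D f boxes) => //.
move=> _ [_ [[a b] _ <-] <-] /=.
have -> : D `&` f @^-1` box a b =
    D `&` \bigcap_(i in [set: I]) (D `&` (fun x => f x i) @^-1` `[a i, b i[).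
  apply/seteqP; split=> x [Dx fx]; split=> //.
    by move=> i _; split=> //=; rewrite in_itv/=; exact: fx.
  by move=> i; have [_ /=] := fx i Logic.I; rewrite in_itv.
apply: measurableI => //; apply: fin_bigcap_measurable => [|i _].
  exact: finite_finset.
exact: mf.
Qed.

(** Turns a finite cover into the infinite sequence that [hausdorff_pre] asks for, padded with the
    empty set. *)
Lemma eseries_nth (V : Type) (x0 : V) (s : seq V) (f : V -> \bar R) :
  f x0 = 0%E -> (forall x, 0 <= f x)%E ->
  (\sum_(0 <= n <oo) f (nth x0 s n) = \sum_(x <- s) f x)%E.
Proof.
move=> f0 fge0; rewrite (nneseries_split _ (size s)) ?add0n; last by move=> *.
rewrite eseries0 ?adde0 -?(big_nth x0 xpredT f)//.
by move=> n sn _; rewrite nth_default.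
Qed.

(* The grid of K ^ #|I| cubes of side s / K has total cost independent of K. *)
Lemma hmeas_cube_lty (a : coords) (s : R) : 0 < s ->
  (hmeas (box a (fun i => a i + s)%R) < +oo)%E.
Proof.
move=> s0.
pose C := unit_ball_volume R #|I| / 2 ^+ #|I| * (Num.sqrt #|I|%:R * s) ^+ #|I|.
apply: (@le_lt_trans _ _ C%:E); last exact: ltry.
apply: ge_ereal_sup => _ [delta delta0 <-].
pose N := Num.bound (Num.sqrt #|I|%:R * s / delta).
have KN : Num.sqrt #|I|%:R * s / delta < N.+1%:R.
  apply: lt_le_trans (archi_boundP _) _; last by rewrite ler_nat.
  by rewrite divr_ge0 ?mulr_ge0 ?sqrtr_ge0// ltW.
pose h := s / N.+1%:R.
have h0 : 0 < h by rewrite divr_gt0.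
pose Q (phi : {ffun I -> 'I_N.+1}) : set coords :=
  box (fun i => a i + (phi i)%:R * h) (fun i => a i + (phi i).+1%:R * h).
have diamQ phi : (diam euclid (Q phi) <= (Num.sqrt #|I|%:R * h)%:E)%E.
  apply: ge_ereal_sup => _ [x Qx [y Qy <-]]; rewrite lee_fin.
  apply: euclid_le => [|i]; first exact: ltW.
  have := Qx i; have := Qy i; rewrite -natr1 => /andP[? ?] /andP[? ?].
  by rewrite ler_norml; apply/andP; split; lra.
have hdelta : Num.sqrt #|I|%:R * h <= delta.
  by rewrite /h mulrA ler_pdivrMr// [delta * _]mulrC -ler_pdivrMr// ltW.
pose s' := [seq Q phi | phi : {ffun I -> 'I_N.+1}].
apply: ge_ereal_inf.
exists (\sum_(0 <= n <oo) hausdorff_term euclid #|I| (nth set0 s' n))%E.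
  exists (nth set0 s') => //; split=> [x xa|n]; last first.
    have [ns|ns] := ltnP n (size s'); last first.
      rewrite nth_default// /diam (_ : [set _ | _ in _ & _ in _] = set0).
        by rewrite ereal_sup0 leNye.
      by apply/seteqP; split=> // ? [].
    have /mapP[phi _ ->] := mem_nth set0 ns.
    by apply: le_trans (diamQ _) _; rewrite lee_fin.
  have tN i : (Num.trunc ((x i - a i) / h) < N.+1)%N.
    have /andP[xa1 xa2] := xa i.
    have xh0 : 0 <= (x i - a i) / h by rewrite divr_ge0 ?subr_ge0// ltW.
    rewrite truncn_lt_nat// ltr_pdivrMr// /h mulrC divfK//; lra.
  pose phi := [ffun i => Ordinal (tN i)].
  have Qx : Q phi x.
    move=> i; rewrite ffunE/=.
    have /andP[xa1 xa2] := xa i.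
    have xh0 : 0 <= (x i - a i) / h by rewrite divr_ge0 ?subr_ge0// ltW.
    have /andP[t1 t2] := truncn_itv xh0.
    by move: t1 t2; rewrite ler_pdivlMr// ltr_pdivrMr// => *; lra.
  have phis : Q phi \in s' by apply: map_f; rewrite mem_enum.
  by exists (index (Q phi) s') => //; rewrite nth_index.
rewrite eseries_nth; [|exact: hausdorff_term_set0|exact: hausdorff_term_ge0 euclid_ge0 _].
rewrite big_image/=.
apply: (@le_trans _ _ (\sum_(phi : {ffun I -> 'I_N.+1})
    (unit_ball_volume R #|I| / 2 ^+ #|I| * (Num.sqrt #|I|%:R * h) ^+ #|I|)%:E)%E).
  apply: lee_sum => phi _.
  have [->|/set0P Q0] := eqVneq (Q phi) set0.
    rewrite hausdorff_term_set0 lee_fin.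
    rewrite mulr_ge0 ?divr_ge0 ?exprn_ge0 ?mulr_ge0 ?sqrtr_ge0//.
      by rewrite ltW// unit_ball_volume_gt0.
    exact: ltW.
  rewrite hausdorff_termN0// [leRHS]EFinM lee_wpmul2l//.
    by rewrite lee_fin divr_ge0// ltW// unit_ball_volume_gt0.
  rewrite EFin_expe; apply: lee_expe2r => //.
  by apply: diam_ge0 => //; exact: euclid_ge0.
rewrite sumEFin lee_fin sumr_const card_ffun card_ord -[leLHS]mulr_natl natrX /C.
by rewrite mulrCA -exprMn mulrCA /h [N.+1%:R * _]mulrC divfK.
Qed.

End euclidean.

(* A nonnegative additive function on [0, +oo[ is monotone, hence linear. *)
Lemma additive_nonneg_linear (R : realType) (phi : R -> R) :
  (forall s, 0 <= s -> 0 <= phi s) ->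
  (forall s t, 0 <= s -> 0 <= t -> phi (s + t) = phi s + phi t) ->
  forall k t, 0 <= k -> 0 <= t -> phi (k * t) = k * phi t.
Proof.
move=> phi0 phiD.
have phi00 : phi 0 = 0 by have := phiD 0 0 (lexx _) (lexx _); rewrite addr0; lra.
have phi_mono s t : 0 <= s -> s <= t -> phi s <= phi t.
  move=> s0 st; rewrite -(subrK s t) phiD ?subr_ge0// lerDr.
  by rewrite phi0// subr_ge0.
have phiMn n t : 0 <= t -> phi (n%:R * t) = n%:R * phi t.
  move=> t0; elim: n => [|n IH]; first by rewrite !mul0r.
  by rewrite -natr1 !mulrDl !mul1r phiD ?IH// mulr_ge0.
move=> k t k0 t0; apply/eqP; rewrite -subr_eq0 -normr_le0.
apply/ler_addgt0Pr => eps eps0; rewrite add0r.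
have [n neps] : exists n, phi t / eps < n.+1%:R.
  exists (Num.bound (phi t / eps)); apply: lt_le_trans (archi_boundP _) _.
    by rewrite divr_ge0 ?phi0// ltW.
  by rewrite ler_nat.
set N : R := n.+1%:R in neps; have N0 : 0 < N by rewrite /N.
have Nk0 : 0 <= N * k by rewrite mulr_ge0// ltW.
have /andP[t1 t2] := truncn_itv Nk0.
(* Both [phi (k * t)] and [k * phi t] lie between [m / N * phi t] and [(m + 1) / N * phi t], and [N]
   was chosen to make the distance [phi t / N] of these bounds smaller than [eps]. *)
set m := Num.trunc _ in t1 t2.
have h1 : m%:R * phi t <= N * phi (k * t).
  rewrite -phiMn// -phiMn ?mulr_ge0//; apply: phi_mono; first by rewrite mulr_ge0.
  by rewrite mulrA ler_wpM2r.
have h2 : N * phi (k * t) <= m.+1%:R * phi t.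
  rewrite -phiMn// -phiMn ?mulr_ge0//; apply: phi_mono.
    by rewrite !mulr_ge0// ltW.
  by rewrite mulrA ler_wpM2r// ltW.
have pt := phi0 t t0.
have h3 : m%:R * phi t <= N * (k * phi t) by rewrite mulrA ler_wpM2r.
have h4 : N * (k * phi t) <= m.+1%:R * phi t by rewrite mulrA ler_wpM2r// ltW.
have : N * `|phi (k * t) - k * phi t| <= N * eps.
  rewrite -[X in X * `|_|](ger0_norm (ltW N0)) -normrM mulrBr.
  apply: (@le_trans _ _ (phi t)).
    by rewrite ler_norml; move: h2 h4; rewrite -natr1 mulrDl => *; lra.
  by rewrite -ler_pdivrMr// ltW.
by rewrite ler_pM2l.
Qed.

(** * Scaling of coordinates in top dimension *)

Section scaling.
Context (R : realType) (I : finType).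
Local Notation coords := (coords R I).
Local Notation bcoords := (bcoords R I).
Local Notation hmeas := (@hmeas R I).

Lemma hmeas_box_lty (a b : coords) : (hmeas (box a b) < +oo)%E.
Proof.
pose s := \sum_i `|b i - a i| + 1.
have s0 : 0 < s by rewrite ltr_wpDl// sumr_ge0.
apply: le_lt_trans (hmeas_cube_lty a s0); apply: le_outer_measure => x xab i.
have /andP[-> xb] := xab i; apply: lt_le_trans xb _.
rewrite -lerBlDl; apply: le_trans (ler_norm _) _.
by rewrite /s (bigD1 i)//= -addrA lerDl addr_ge0// sumr_ge0.
Qed.

Definition shift_at (i : I) (t : R) (x : coords) : coords :=
  fun j => if j == i then x j + t else x j.

Definition scale_at (i : I) (k : R) (x : coords) : coords :=
  fun j => if j == i then k * x j else x j.

Lemma hmeas_shift (i : I) (t : R) (E : set coords) :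
  hmeas (shift_at i t @` E) = hmeas E.
Proof.
apply: hausdorff_isometry; [exact: euclid_ge0|exact: euclid_ge0|..].
  move=> x y /funeqP xy; apply/funext => j; have := xy j.
  by rewrite /shift_at; case: eqP => // _ /addIr.
move=> x y _ _; congr (Num.sqrt _); apply: eq_bigr => j _.
by rewrite /shift_at; case: eqP => // _; congr (_ ^+ 2); lra.
Qed.

Definition set_at (i : I) (u : R) (x : coords) : coords :=
  fun j => if j == i then u else x j.

Lemma hmeas_box_slide (a b : coords) (i : I) (u t : R) :
  hmeas (box (set_at i u a) (set_at i (u + t) b)) =
  hmeas (box (set_at i 0 a) (set_at i t b)).
Proof.
rewrite -(hmeas_shift i u (box (set_at i 0 a) (set_at i t b))); congr hmeas.
apply/seteqP; split=> [x xab|_ [x xab <-] j].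
  exists (shift_at i (- u) x); last first.
    by apply/funext => j; rewrite /shift_at; case: eqP => // _; rewrite subrK.
  move=> j; have := xab j; rewrite /shift_at /set_at.
  by case: eqP => // _; rewrite subr_ge0 ltrBlDl.
have := xab j; rewrite /shift_at /set_at; case: eqP => // _.
by rewrite lerDr addrC ltrD2l.
Qed.

(** The half-space [x i < s] splits the box exactly, and a translation brings the upper part back to
    start at [0]. *)
Lemma hmeas_box_split (a b : coords) (i : I) (s t : R) : 0 <= s -> 0 <= t ->
  hmeas (box (set_at i 0 a) (set_at i (s + t) b)) =
  (hmeas (box (set_at i 0 a) (set_at i s b)) +
   hmeas (box (set_at i 0 a) (set_at i t b)))%E.
Proof.
move=> s0 t0; rewrite (@hmeas_halfspace _ _ i s (box _ _)).
rewrite -[in RHS](hmeas_box_slide a b i s t).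
congr (hmeas _ + hmeas _)%E; apply/seteqP; split=> x.
- move=> [xab /= xs] j; have := xab j; rewrite /set_at.
  by case: eqP => [->|//]; rewrite xs => /andP[->].
- move=> xab; split=> [j|].
    have := xab j; rewrite /set_at; case: eqP => // _ /andP[-> xs] /=.
    by rewrite (lt_le_trans xs)// lerDl.
  by have := xab i; rewrite /set_at eqxx => /andP[].
- move=> [xab /= /negP]; rewrite -leNgt => xs j; have := xab j; rewrite /set_at.
  by case: eqP => [->|//]; rewrite xs => /andP[_].
- move=> xab; split=> [j|/=].
    have := xab j; rewrite /set_at; case: eqP => // _ /andP[xs ->].
    by rewrite (le_trans s0).
  by have := xab i; rewrite /set_at eqxx => /andP[+ _]; rewrite leNgt => /negP.
Qed.

Lemma hmeas_box_scale (a b : coords) (i : I) (k : R) : 0 < k ->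
  hmeas (box (scale_at i k a) (scale_at i k b)) = (k%:E * hmeas (box a b))%E.
Proof.
(* If [b i < a i], both boxes are empty. Otherwise the side [b i - a i] is nonnegative, which is the
   range where [phi] is linear. *)
move=> k0; have [ba|ab] := ltP (b i) (a i).
  have box0 (x y : coords) : y i < x i -> box x y = set0.
    move=> yx; apply/seteqP; split=> // z /(_ i) /andP[z1 z2].
    by have := lt_trans (le_lt_trans z1 z2) yx; rewrite ltxx.
  rewrite !box0 ?outer_measure0 ?mule0//.
  by rewrite /scale_at eqxx ltr_pM2l.
pose phi t := fine (hmeas (box (set_at i 0 a) (set_at i t b))).
have phiE t : (phi t)%:E = hmeas (box (set_at i 0 a) (set_at i t b)).
  by rewrite fineK// ge0_fin_numE ?outer_measure_ge0// hmeas_box_lty.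
have boxE (l : R) : 0 < l -> box (scale_at i l a) (scale_at i l b) =
    box (set_at i (l * a i) a) (set_at i (l * a i + l * (b i - a i)) b).
  move=> l0; congr box; apply/funext => j; rewrite /scale_at /set_at;
    case: eqP => // -> //.
  by lra.
(* Reading [box a b] as its own scaling by [1] lets [boxE] rewrite both sides alike. *)
have box1 : box a b = box (scale_at i 1 a) (scale_at i 1 b).
  by congr box; apply/funext => j; rewrite /scale_at mul1r; case: ifP.
rewrite box1 !boxE// !hmeas_box_slide -!phiE -EFinM mul1r; congr EFin.
apply: (@additive_nonneg_linear _ phi).
- by move=> s _; rewrite fine_ge0// outer_measure_ge0.
- move=> s t s0 t0; apply: EFin_inj.
  by rewrite EFinD !phiE hmeas_box_split.
- exact: ltW.
- by rewrite subr_ge0.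
Qed.

Lemma setI_closed_boxes : setI_closed (@boxes R I).
Proof.
move=> _ _ [[a b] _ <-] [[c d] _ <-] /=.
exists (fun i => Num.max (a i) (c i), fun i => Num.min (b i) (d i)) => //=.
apply/seteqP; split=> x.
  move=> xabcd; split=> i; have := xabcd i;
  by rewrite ge_max lt_min => /andP[/andP[? ?] /andP[? ?]]; apply/andP; split.
move=> [xab xcd] i; have /andP[? ?] := xab i; have /andP[? ?] := xcd i.
by rewrite ge_max lt_min; apply/andP; split; apply/andP; split.
Qed.

Lemma bigcup_box (c : coords) :
  \bigcup_n box (fun i => c i - n%:R) (fun i => c i + n%:R) = setT.
Proof.
apply/seteqP; split=> // x _.
have := @archi_boundP R (\sum_j `|x j - c j|) (sumr_ge0 _ (fun j _ => normr_ge0 _)).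
set n := Num.bound _ => xn; exists n => // i.
have : `|x i - c i| < n%:R.
  by apply: le_lt_trans xn; rewrite (bigD1 i)//= lerDl sumr_ge0.
by rewrite ltr_norml => /andP[? ?]; apply/andP; split; lra.
Qed.

Lemma measurable_scale_at (i : I) (k : R) :
  measurable_fun [set: bcoords] (scale_at i k : bcoords -> bcoords).
Proof.
apply: measurable_fun_coords => j; rewrite /scale_at.
case: eqP => _; last exact: measurable_coord.
apply: measurable_funM => //; exact: measurable_coord.
Qed.

Section scaled_measure.
Variables (i : I) (k : R).

Definition scaled_measure : set bcoords -> \bar R :=
  fun E => bmeas (scale_at i k @^-1` E).

Let scaled_measure0 : scaled_measure set0 = 0%E.
Proof. by rewrite /scaled_measure preimage_set0 measure0. Qed.

Let scaled_measure_ge0 E : (0 <= scaled_measure E)%E.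
Proof. exact: outer_measure_ge0. Qed.

Let scaled_measure_sigma_additive : semi_sigma_additive scaled_measure.
Proof.
have mE (E : set bcoords) : measurable E ->
    measurable (scale_at i k @^-1` E : set bcoords).
  by move=> mE; rewrite -[X in measurable X]setTI; exact: measurable_scale_at.
move=> F mF tF mUF; rewrite /scaled_measure preimage_bigcup.
apply: measure_semi_sigma_additive => [n||].
- exact: mE.
- apply/trivIsetP => /= l j _ _ lj; rewrite -preimage_setI.
  by move/trivIsetP : tF => /(_ _ _ _ _ lj) ->//; rewrite preimage_set0.
- by rewrite -preimage_bigcup; exact: mE.
Qed.

HB.instance Definition _ := isMeasure.Build _ _ _ scaled_measure
  scaled_measure0 scaled_measure_ge0 scaled_measure_sigma_additive.

End scaled_measure.

Lemma preimage_scale_at_box (i : I) (k : R) (a b : coords) : 0 < k ->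
  scale_at i k @^-1` box a b = box (scale_at i k^-1 a) (scale_at i k^-1 b).
Proof.
move=> k0; apply/seteqP; split=> x xab j; have := xab j; rewrite /scale_at;
  by case: eqP => // _; rewrite ler_pdivrMl// ltr_pdivlMl.
Qed.

Lemma hmeas_scale_at (i : I) (k : R) (E : set bcoords) : 0 < k -> measurable E ->
  hmeas (scale_at i k @^-1` E) = (k^-1%:E * hmeas E)%E.
Proof.
move=> k0 mE; have ki0 : 0 <= k^-1 by rewrite invr_ge0 ltW.
have := @measure_unique _ R bcoords (@boxes R I)
  (fun n => box (fun=> 0 - n%:R) (fun=> 0 + n%:R))
  erefl setI_closed_boxes _ (bigcup_box (fun=> 0)) (scaled_measure i k)
  (mscale (NngNum ki0) (@bmeas R I)) _ _ E mE.
apply.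
- by move=> n; exists (fun=> 0 - n%:R, fun=> 0 + n%:R).
- move=> _ [[a b] _ <-] /=; rewrite /mscale/= /scaled_measure /bmeas.
  by rewrite preimage_scale_at_box// hmeas_box_scale ?invr_gt0.
- move=> n; rewrite /= /scaled_measure /bmeas preimage_scale_at_box//.
  exact: hmeas_box_lty.
Qed.

Lemma hmeas_diag (c : coords) (E : set bcoords) : (forall i, 0 < c i) ->
  measurable E ->
  hmeas ((fun (x : coords) i => c i * x i) @` E) = ((\prod_i c i)%:E * hmeas E)%E.
Proof.
move=> c0 mE.
(* The inverse factors turn the image into a preimage, the form of [hmeas_scale_at]. Coordinates are
   rescaled one at a time along an enumeration, whose lack of repetitions ensures that none is
   rescaled twice. *)
pose sc (s : seq I) : coords -> coords :=
  fun x i => if i \in s then (c i)^-1 * x i else x i.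
have -> : (fun (x : coords) i => c i * x i) @` E = sc (enum I) @^-1` E.
  apply/seteqP; split=> [_ [x Ex <-]|x Ex] /=.
    rewrite (_ : sc _ _ = x)//; apply/funext => i.
    by rewrite /sc mem_enum mulKf// gt_eqF.
  exists (sc (enum I) x) => //; apply/funext => i.
  by rewrite /sc mem_enum mulVKf// gt_eqF.
rewrite -big_enum; move: (enum_uniq I); rewrite /=.
elim: (enum I) => [_|i s IH /= /andP[is_ us]].
  rewrite big_nil mul1e; congr hmeas.
have -> : sc (i :: s) @^-1` E = scale_at i (c i)^-1 @^-1` (sc s @^-1` E).
  apply/seteqP; suff scE x : sc (i :: s) x = sc s (scale_at i (c i)^-1 x).
    by split=> x; rewrite /preimage /= scE.
  apply/funext => j; rewrite /sc /scale_at inE.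
  have [->|ji] //= := eqVneq j i; move: is_.
  by case: (i \in s).
rewrite hmeas_scale_at ?invr_gt0//.
  by rewrite IH// big_cons invrK muleA EFinM.
rewrite -[X in measurable X]setTI.
apply: measurable_fun_coords => // j; rewrite /sc.
case: (j \in s); last exact: measurable_coord.
apply: measurable_funM => //; exact: measurable_coord.
Qed.

End scaling.

(* For S inside a bounded box around x0, the dilates of S by 1 + 1 / j about x0
   stay in the box, have measure bounded below by that of S, and no point lies in
   infinitely many of them. *)
Lemma hmeas_finite_rays (R : realType) (I : finType) (S : set (bcoords R I))
    (x0 : coords R I) : measurable S ->
  (forall x : coords R I,
    finite_set [set t : R | S (fun i => x0 i + t * (x i - x0 i))]) ->
  hmeas S = 0%E.
Proof.
move=> mS finS.
pose tau (t : R) (x : coords R I) : coords R I := fun i => x0 i + t * (x i - x0 i).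
pose B n := box (fun i => x0 i - n%:R) (fun i => x0 i + n%:R).
have mtau t : measurable_fun [set: bcoords R I] (tau t : bcoords R I -> bcoords R I).
  apply: measurable_fun_coords => i; apply: measurable_funD => //.
  apply: measurable_funM => //; apply: measurable_funB => //.
  exact: measurable_coord.
pose t j : R := 1 + j.+1%:R^-1.
have t1 j : 1 < t j by rewrite ltrDl invr_gt0.
have t2 j : t j <= 2 by rewrite (_ : 2 = 1 + 1)// lerD2l invf_le1// ler1n.
have t_inj : injective t by move=> i j /addrI /invr_inj /eqP; rewrite eqr_nat => /eqP[].
suff SB n : hmeas (S `&` B n) = 0%E.
  apply/eqP; rewrite eq_le outer_measure_ge0 andbT.
  have -> : S = \bigcup_n (S `&` B n) by rewrite -setI_bigcupr bigcup_box setIT.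
  apply: le_trans (outer_measure_sigma_subadditive _ _) _.
  by rewrite eseries0// => i _ _; exact: SB.
(* [N j] is the contraction about [x0] by the factor [t j]. As [t j > 1] it stays in [B n], and as
   [t j <= 2] its measure drops at most by the factor [2 ^+ #|I|]. *)
pose N j := tau (t j) @^-1` (S `&` B n).
have mN j : measurable (N j : set (bcoords R I)).
  rewrite -[X in measurable X]setTI; apply: mtau => //.
  by apply: measurableI => //; exact: measurable_box.
pose F j := \bigcup_(l in [set l | (j <= l)%N]) N l.
have mF j : measurable (F j : set (bcoords R I)) by apply: bigcup_measurable.
have NB j : N j `<=` B n.
  move=> x [_ xB] i; have := xB i; have := t1 j; rewrite /tau.
  set y := x i - x0 i; have -> : x i = x0 i + y by rewrite /y; lra.
  set s := t j; rewrite lerBlDr -!addrA lerDl ltrD2l => s1 /andP[y1 y2].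
  have [y0|y0] := leP 0 y.
    have : y <= s * y by rewrite ler_peMl// ltW.
    by move=> ?; apply/andP; split; lra.
  have : s * y <= y by rewrite ler_neMl// ltW.
  by move=> ?; apply/andP; split; lra.
have FB j : F j `<=` B n by move=> x [l _ /NB].
have F0 : \bigcap_j F j = set0.
  apply/seteqP; split=> // x xF.
  have : finite_set [set l | N l x].
    have Nsub : [set l | N l x] `<=` t @^-1` [set u : R | S (tau u x)] by move=> l [].
    apply: sub_finite_set Nsub _; apply: finite_preimage (finS x).
    by move=> i j _ _; exact: t_inj.
  move=> /finite_seqP[s sE].
  have [l /= sl Nl] := xF (\max_(l <- s) l).+1 Logic.I.
  have : [set l | N l x] l by [].
  rewrite sE /= => ls.
  by move: sl; rewrite ltnNge (@leq_bigmax_seq _ s xpredT id l ls).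
have cvgF : @bmeas R I \o F @ \oo --> (0 : \bar R)%E.
  rewrite -(measure0 (@bmeas R I)) -F0.
  apply: nonincreasing_cvg_mu => //.
  - apply: le_lt_trans (hmeas_box_lty (fun i => x0 i - n%:R) (fun i => x0 i + n%:R)).
    exact: le_outer_measure.
  - by rewrite F0; exact: measurable0.
  - move=> i j ij; apply/subsetPset => x [l /= jl Nl].
    by exists l => //=; exact: leq_trans jl.
have lowF j : ((2 ^+ #|I|)^-1%:E * hmeas (S `&` B n) <= @bmeas R I (F j))%E.
  rewrite lee_pdivrMl ?exprn_gt0//.
  apply: (@le_trans _ _ (hmeas (tau (t j) @` N j))).
    apply: le_outer_measure => x Sx.
    have tj0 : t j != 0 by rewrite gt_eqF// (lt_trans _ (t1 j)).
    have tauK : tau (t j) (tau (t j)^-1 x) = x.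
      by apply/funext => i; rewrite /tau addrAC subrr add0r mulVKf// addrC subrK.
    by exists (tau (t j)^-1 x) => //; rewrite /N /= tauK.
  have t0 : 0 < t j by apply: lt_trans (t1 j).
  apply: (@le_trans _ _ ((t j ^+ #|I|)%:E * hmeas (N j))%E).
    apply: hausdorff_lipschitz; [exact: euclid_ge0|exact: euclid_ge0|by []|].
    move=> x y _ _; rewrite /euclid -[t j in leRHS](ger0_norm (ltW t0)).
    rewrite -sqrtr_sqr -sqrtrM ?sqr_ge0//.
    apply: ler_wsqrtr; rewrite mulr_sumr; apply: ler_sum => i _.
    by rewrite -exprMn /tau le_eqVlt; apply/orP; left; apply/eqP; congr (_ ^+ 2); lra.
  apply: (@le_trans _ _ ((2 ^+ #|I|)%:E * hmeas (N j))%E).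
    rewrite lee_wpmul2r ?outer_measure_ge0// lee_fin lerXn2r ?nnegrE ?ler0n// ltW//.
  rewrite lee_wpmul2l ?lee_fin ?exprn_ge0//.
  by apply: le_outer_measure => x Nx; exists j => /=.
have : ((2 ^+ #|I|)^-1%:E * hmeas (S `&` B n) <= 0)%E.
  rewrite -(cvg_lim _ cvgF)//; apply: lime_ge.
    by apply/cvg_ex; eexists; exact: cvgF.
  by apply: nearW => j; exact: lowF.
rewrite lee_pdivrMl ?exprn_gt0// mule0 => le0.
by apply/eqP; rewrite eq_le le0 outer_measure_ge0.
Qed.

(** * Cayley-Dickson algebras *)

Section cd_algebra.
Context (R : realType).

Fixpoint cd_dot (k : nat) : cd R k -> cd R k -> R :=
  match k with
  | 0 => fun x y : R => x * y
  | k'.+1 => fun x y => cd_dot x.1 y.1 + cd_dot x.2 y.2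
  end.

Lemma cd_eq k (x y : cd R k.+1) : x.1 = y.1 -> x.2 = y.2 -> x = y.
Proof. by case: x y => [a b] [c d] /= -> ->. Qed.

Lemma cd_conjD k (x y : cd R k) : cd_conj (x + y) = cd_conj x + cd_conj y.
Proof. by elim: k x y => //= k IH x y; apply: cd_eq => /=; rewrite ?IH ?opprD. Qed.

Lemma cd_conjZ k (r : R) (x : cd R k) : cd_conj (r *: x) = r *: cd_conj x.
Proof. by elim: k x => //= k IH x; apply: cd_eq => /=; rewrite ?IH ?scalerN. Qed.

Lemma cd_conjN k (x : cd R k) : cd_conj (- x) = - cd_conj x.
Proof. by rewrite -scaleN1r cd_conjZ scaleN1r. Qed.

Lemma cd_conj0 k : cd_conj (0 : cd R k) = 0.
Proof. by have := cd_conjZ 0 (0 : cd R k); rewrite !scale0r. Qed.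

Lemma cd_conjK k : involutive (@cd_conj R k).
Proof. by elim: k => //= k IH x; apply: cd_eq => /=; rewrite ?IH ?opprK. Qed.

Lemma cd_mulDl_Dr k :
  (forall x y z : cd R k, cd_mul (x + y) z = cd_mul x z + cd_mul y z) /\
  (forall x y z : cd R k, cd_mul z (x + y) = cd_mul z x + cd_mul z y).
Proof.
elim: k => [|k [IHl IHr]]; first by split=> x y z /=; rewrite (mulrDl, mulrDr).
by split=> x y z; apply: cd_eq => /=; rewrite ?cd_conjD !IHl !IHr ?opprD addrACA.
Qed.

Lemma cd_mulDl k (x y z : cd R k) : cd_mul (x + y) z = cd_mul x z + cd_mul y z.
Proof. exact: (cd_mulDl_Dr k).1. Qed.

Lemma cd_mulDr k (x y z : cd R k) : cd_mul z (x + y) = cd_mul z x + cd_mul z y.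
Proof. exact: (cd_mulDl_Dr k).2. Qed.

Lemma cd_mulZl_Zr k (r : R) :
  (forall x y : cd R k, cd_mul (r *: x) y = r *: cd_mul x y) /\
  (forall x y : cd R k, cd_mul x (r *: y) = r *: cd_mul x y).
Proof.
elim: k => [|k [IHl IHr]].
  by split=> x y; [exact/esym/mulrA|exact: mulrCA].
by split=> x y; apply: cd_eq => /=; rewrite ?cd_conjZ !IHl !IHr ?scalerBr ?scalerDr.
Qed.

Lemma cd_mulZl k (r : R) (x y : cd R k) : cd_mul (r *: x) y = r *: cd_mul x y.
Proof. exact: (cd_mulZl_Zr k r).1. Qed.

Lemma cd_mulZr k (r : R) (x y : cd R k) : cd_mul x (r *: y) = r *: cd_mul x y.
Proof. exact: (cd_mulZl_Zr k r).2. Qed.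

Lemma cd_mul0l k (x : cd R k) : cd_mul 0 x = 0.
Proof. by have := cd_mulZl 0 (0 : cd R k) x; rewrite !scale0r. Qed.

Lemma cd_mul0r k (x : cd R k) : cd_mul x 0 = 0.
Proof. by have := cd_mulZr 0 x (0 : cd R k); rewrite !scale0r. Qed.

Lemma cd_mulNl k (x y : cd R k) : cd_mul (- x) y = - cd_mul x y.
Proof. by rewrite -scaleN1r cd_mulZl scaleN1r. Qed.

Lemma cd_mulNr k (x y : cd R k) : cd_mul x (- y) = - cd_mul x y.
Proof. by rewrite -scaleN1r cd_mulZr scaleN1r. Qed.

Lemma cd_mul_suml k (J : Type) (s : seq J) (F : J -> cd R k) y :
  cd_mul (\sum_(j <- s) F j) y = \sum_(j <- s) cd_mul (F j) y.
Proof.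
by elim/big_rec2: _ => [|j _ x _ <-]; rewrite ?cd_mul0l// cd_mulDl.
Qed.

Lemma cd_mul_sumr k (J : Type) (s : seq J) (F : J -> cd R k) x :
  cd_mul x (\sum_(j <- s) F j) = \sum_(j <- s) cd_mul x (F j).
Proof.
by elim/big_rec2: _ => [|j _ y _ <-]; rewrite ?cd_mul0r// cd_mulDr.
Qed.

Lemma cd_conj_sum k (J : Type) (s : seq J) (F : J -> cd R k) :
  cd_conj (\sum_(j <- s) F j) = \sum_(j <- s) cd_conj (F j).
Proof.
by elim/big_rec2: _ => [|j _ y _ <-]; rewrite ?cd_conj0// cd_conjD.
Qed.

Lemma cd_conjM k (x y : cd R k) :
  cd_conj (cd_mul x y) = cd_mul (cd_conj y) (cd_conj x).
Proof.
elim: k x y => [|k IH] x y; first exact: mulrC.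
apply: cd_eq => /=.
  by rewrite cd_conjD cd_conjN !IH cd_conjK cd_conjN cd_mulNl cd_mulNr opprK.
by rewrite cd_conjK !cd_mulNl opprD addrC.
Qed.

Lemma cd_dotDl k (x y z : cd R k) : cd_dot (x + y) z = cd_dot x z + cd_dot y z.
Proof. by elim: k x y z => [|k IH] x y z /=; rewrite ?mulrDl// !IH addrACA. Qed.

Lemma cd_dotZl k (r : R) (x y : cd R k) : cd_dot (r *: x) y = r * cd_dot x y.
Proof. by elim: k x y => [|k IH] x y /=; rewrite /= -?mulrA// !IH mulrDr. Qed.

Lemma cd_dotC k (x y : cd R k) : cd_dot x y = cd_dot y x.
Proof. by elim: k x y => [|k IH] x y /=; [exact: mulrC|congr (_ + _)]. Qed.

Lemma cd_dotDr k (x y z : cd R k) : cd_dot z (x + y) = cd_dot z x + cd_dot z y.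
Proof. by rewrite cd_dotC cd_dotDl !(cd_dotC z). Qed.

Lemma cd_dotZr k (r : R) (x y : cd R k) : cd_dot x (r *: y) = r * cd_dot x y.
Proof. by rewrite cd_dotC cd_dotZl cd_dotC. Qed.

Lemma cd_dotNl k (x y : cd R k) : cd_dot (- x) y = - cd_dot x y.
Proof. by rewrite -scaleN1r cd_dotZl mulN1r. Qed.

Lemma cd_dotNr k (x y : cd R k) : cd_dot x (- y) = - cd_dot x y.
Proof. by rewrite -scaleN1r cd_dotZr mulN1r. Qed.

Lemma cd_dot0l k (x : cd R k) : cd_dot 0 x = 0.
Proof. by have := cd_dotZl 0 (0 : cd R k) x; rewrite !(scale0r, mul0r). Qed.

Lemma cd_dot_suml k (J : Type) (s : seq J) (F : J -> cd R k) y :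
  cd_dot (\sum_(j <- s) F j) y = \sum_(j <- s) cd_dot (F j) y.
Proof. by elim/big_rec2: _ => [|j _ x _ <-]; rewrite ?cd_dot0l// cd_dotDl. Qed.

Lemma cd_dot_sumr k (J : Type) (s : seq J) (F : J -> cd R k) x :
  cd_dot x (\sum_(j <- s) F j) = \sum_(j <- s) cd_dot x (F j).
Proof. by rewrite cd_dotC cd_dot_suml; apply: eq_bigr => j _; rewrite cd_dotC. Qed.

Lemma cd_normsqE k (x : cd R k) : cd_normsq x = cd_dot x x.
Proof. by elim: k x => [|k IH] x /=; rewrite ?expr2// !IH. Qed.

Lemma cd_normsq_ge0 k (x : cd R k) : 0 <= cd_normsq x.
Proof. by elim: k x => [|k IH] x /=; rewrite ?sqr_ge0// addr_ge0. Qed.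

Lemma cd_normsq_eq0 k (x : cd R k) : (cd_normsq x == 0) = (x == 0).
Proof.
elim: k x => [|k IH] x /=; first by rewrite sqrf_eq0.
by rewrite paddr_eq0 ?cd_normsq_ge0// !IH; case: x.
Qed.

Lemma cd_dot_eq k (x y : cd R k) : (forall w, cd_dot x w = cd_dot y w) -> x = y.
Proof.
move=> xy; apply/eqP; rewrite -subr_eq0 -cd_normsq_eq0 cd_normsqE cd_dotDl cd_dotNl.
by rewrite xy subrr.
Qed.

Lemma cd_dot_conj k (x y : cd R k) : cd_dot (cd_conj x) (cd_conj y) = cd_dot x y.
Proof. by elim: k x y => //= k IH x y; rewrite IH cd_dotNl cd_dotNr opprK. Qed.

Lemma cd_normsq_conj k (x : cd R k) : cd_normsq (cd_conj x) = cd_normsq x.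
Proof. by rewrite !cd_normsqE cd_dot_conj. Qed.

(** The adjoint relation survives the loss of associativity: it passes through the doubling, once
    the version for right multiplication has been derived from the induction hypothesis by
    conjugating. *)
Lemma cd_dot_mull k (a x y : cd R k) :
  cd_dot (cd_mul a x) y = cd_dot x (cd_mul (cd_conj a) y).
Proof.
elim: k a x y => [|k IH] a x y; first by rewrite /= mulrCA mulrA.
have IHr (b u v : cd R k) : cd_dot (cd_mul u b) v = cd_dot u (cd_mul v (cd_conj b)).
  by rewrite -cd_dot_conj cd_conjM IH -(cd_dot_conj u) cd_conjM !cd_conjK.
rewrite /= cd_mulNl cd_mulNr opprK !(cd_dotDl, cd_dotDr, cd_dotNl, cd_dotNr).
rewrite (IH a.1 x.1) (IHr a.2 (cd_conj x.2)) (IHr a.1 x.2) (IH a.2 (cd_conj x.1)).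
rewrite -[cd_dot (cd_conj x.2) _]cd_dot_conj cd_conjK cd_conjM cd_conjK.
by rewrite -[cd_dot (cd_conj x.1) _]cd_dot_conj cd_conjK cd_conjM cd_conjK; lra.
Qed.

Lemma cd_dot_mulr k (a x y : cd R k) :
  cd_dot (cd_mul x a) y = cd_dot x (cd_mul y (cd_conj a)).
Proof.
by rewrite -cd_dot_conj cd_conjM cd_dot_mull -(cd_dot_conj x) cd_conjM !cd_conjK.
Qed.

Lemma cd_mulA k (x y z : cd R k) : (k <= 2)%N ->
  cd_mul x (cd_mul y z) = cd_mul (cd_mul x y) z.
Proof.
case: k x y z => [|[|[|//]]] x y z _; first exact: mulrA.
  by apply: cd_eq => /=; ring.
by apply: cd_eq; apply: (@cd_eq 0) => /=; ring.
Qed.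

End cd_algebra.

(** * Multiplicativity of the norm and its consequences *)

Section cd_composition.
Context (R : realType).

Lemma cd_normsqD k (x y : cd R k) :
  cd_normsq (x + y) = cd_normsq x + cd_normsq y + 2 * cd_dot x y.
Proof. by rewrite !cd_normsqE cd_dotDl !cd_dotDr (cd_dotC y x); lra. Qed.

Lemma cd_normsqZ k (r : R) (x : cd R k) : cd_normsq (r *: x) = r ^+ 2 * cd_normsq x.
Proof. by rewrite !cd_normsqE cd_dotZl cd_dotZr expr2 mulrA. Qed.

Lemma cd_normsqN k (x : cd R k) : cd_normsq (- x) = cd_normsq x.
Proof. by rewrite -scaleN1r cd_normsqZ sqrrN expr1n mul1r. Qed.

(* The doubling formula is multiplicative because the cross terms cancel as soon
   as the halved algebra is associative. *)
Lemma cd_normsqM k (x y : cd R k) : (k <= 3)%N ->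
  cd_normsq (cd_mul x y) = cd_normsq x * cd_normsq y.
Proof.
elim: k x y => [|k IH] x y k3; first exact: exprMn.
rewrite /= !cd_normsqD cd_normsqN !IH ?(ltnW k3)// !cd_normsq_conj cd_dotNr.
have -> : cd_dot (cd_mul x.1 y.1) (cd_mul (cd_conj y.2) x.2) =
    cd_dot (cd_mul y.2 (cd_mul x.1 y.1)) x.2.
  by rewrite [RHS]cd_dot_mull.
have -> : cd_dot (cd_mul y.2 x.1) (cd_mul x.2 (cd_conj y.1)) =
    cd_dot (cd_mul (cd_mul y.2 x.1) y.1) x.2.
  by rewrite [RHS]cd_dot_mulr.
by rewrite cd_mulA//; lra.
Qed.

Lemma cd_dot_mulM k (a x y : cd R k) : (k <= 3)%N ->
  cd_dot (cd_mul a x) (cd_mul a y) = cd_normsq a * cd_dot x y.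
Proof.
move=> k3; have := cd_normsqM a (x + y) k3.
by rewrite cd_mulDr !cd_normsqD !cd_normsqM// => ?; lra.
Qed.

(** A form of alternativity that stands in for associativity over the octonions. Left multiplication
    by [a] scales the inner product by [cd_normsq a], and its adjoint is left multiplication by the
    conjugate. *)
Lemma cd_conj_mulK k (a x : cd R k) : (k <= 3)%N ->
  cd_mul (cd_conj a) (cd_mul a x) = cd_normsq a *: x.
Proof.
move=> k3; apply: cd_dot_eq => w.
by rewrite cd_dot_mull cd_conjK cd_dot_mulM// cd_dotZl.
Qed.

Lemma cd_mul_conjK k (a x : cd R k) : (k <= 3)%N ->
  cd_mul (cd_mul x (cd_conj a)) a = cd_normsq a *: x.
Proof.
move=> k3; apply: (can_inj (@cd_conjK R k)).
by rewrite !cd_conjM cd_conjK cd_conj_mulK// cd_conjZ.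
Qed.

End cd_composition.

(** * Ordered elements of a finite set of reals *)

Section ith_largest.
Context (R : realType).
Implicit Types S : set R.

Let elems S : seq R := enum_fset (fset_set S).

Lemma size_fset_set_card S n : (S #= `I_n)%card -> size (elems S) = n.
Proof. by move=> Sn; apply: card_fset_set. Qed.

Lemma ith_largest_in S n i : (S #= `I_n)%card -> (i < n)%N -> S (ith_largest S i).
Proof.
move=> Sn iN; have finS : finite_set S by exists n.
have : ith_largest S i \in elems S.
  by rewrite -(mem_sort >=%R) mem_nth// size_sort (size_fset_set_card Sn).
by rewrite /elems/= in_fset_set// inE.
Qed.

Lemma ith_largest_inj S n i j : (S #= `I_n)%card -> (i < n)%N -> (j < n)%N ->
  ith_largest S i = ith_largest S j -> i = j.
Proof.
move=> Sn iN jN /eqP; rewrite nth_uniq ?size_sort ?(size_fset_set_card Sn)//.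
  by move/eqP.
by rewrite sort_uniq fset_uniq.
Qed.

Lemma ith_largest0 S s : finite_set S -> S s -> (forall t, S t -> t <= s) ->
  ith_largest S 0 = s.
Proof.
move=> finS Ss maxs; have sS : s \in sort >=%R (elems S).
  by rewrite mem_sort /elems/= in_fset_set// inE.
have hS : ith_largest S 0 \in elems S.
  by rewrite -(mem_sort >=%R) mem_nth//; move: sS; case: sort.
apply/eqP; rewrite eq_le; apply/andP; split.
  by apply: maxs; move: hS; rewrite /elems/= in_fset_set// inE.
rewrite /ith_largest -/(elems S); move: sS.
have := sort_sorted (fun x y => le_total y x) (elems S).
case: sort => //= t l; rewrite path_sortedE; last first.
  by move=> ? ? ? /[swap]; exact: le_trans.
by move=> /andP[/allP tl _]; rewrite inE => /predU1P[->//|/tl].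
Qed.

(** A map that preserves and reflects the order on [S] sends the sorted list of [S] to that of its
    image. It is applied to squaring on positive singular values. *)
Lemma ith_largest_image S n (f : R -> R) i : (S #= `I_n)%card -> (i < n)%N ->
  (forall s t, S s -> S t -> (f s <= f t) = (s <= t)) ->
  ith_largest (f @` S) i = f (ith_largest S i).
Proof.
move=> Sn iN fS; have finS : finite_set S by exists n.
have finj s t : S s -> S t -> f s = f t -> s = t.
  by move=> Ss St fst; apply/eqP; rewrite eq_le -(fS _ _ Ss St) -(fS _ _ St Ss) fst lexx.
rewrite /ith_largest -(nth_map 0 0) ?size_sort ?(size_fset_set_card Sn)//; congr nth.
have memE x : x \in elems S = (x \in S) by rewrite in_fset_set.
apply: (@sorted_eq _ >=%R).
- by move=> ? ? ? /[swap]; exact: le_trans.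
- by move=> x y; rewrite andbC => /le_anti.
- exact: (sort_sorted (fun x y => le_total y x)).
- have := sort_sorted (fun x y => le_total y x) (elems S).
  rewrite sorted_map; apply: (@sub_in_sorted _ [in sort >=%R (elems S)]); last exact/allP.
  by move=> x y; rewrite !mem_sort !memE !inE => Sx Sy /=; rewrite fS.
- apply: uniq_perm.
  + by rewrite sort_uniq fset_uniq.
  + rewrite map_inj_in_uniq ?sort_uniq ?fset_uniq// => x y.
    by rewrite !mem_sort !memE !inE => Sx Sy; exact: finj.
  + move=> x; rewrite mem_sort in_fset_set; last exact: finite_image.
    apply/idP/mapP => [/set_mem[y Sy <-]|[y + ->]].
      by exists y => //; rewrite mem_sort memE inE.
    by rewrite mem_sort memE inE => /set_mem Sy; exists y.
Qed.

End ith_largest.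

(** * Norms, inner products and singular vectors *)

Section vectors.
Context (R : realType) (k : nat).
Local Notation F := (cd R k).

Definition mxnormsq n m (X : 'M[F]_(n, m)) : R := \sum_i \sum_j cd_normsq (X i j).

Lemma mxnormsq_ge0 n m (X : 'M[F]_(n, m)) : 0 <= mxnormsq X.
Proof. by apply: sumr_ge0 => i _; apply: sumr_ge0 => j _; exact: cd_normsq_ge0. Qed.

Lemma mxnormsq_eq0 n m (X : 'M[F]_(n, m)) : (mxnormsq X == 0) = (X == 0).
Proof.
apply/eqP/eqP => [X0|->]; last first.
  rewrite /mxnormsq big1// => i _; rewrite big1// => j _.
  by apply/eqP; rewrite mxE cd_normsq_eq0.
apply/matrixP => i j; rewrite mxE; apply/eqP; rewrite -cd_normsq_eq0.
have := X0; move/psumr_eq0P => /(_ (fun i _ => sumr_ge0 _ (fun j _ => cd_normsq_ge0 _))).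
move/(_ i isT)/psumr_eq0P => /(_ (fun j _ => cd_normsq_ge0 _)) /(_ j isT).
by move/eqP.
Qed.

Lemma cd_mulmxB n m p (A : 'M[F]_(n, m)) (X Y : 'M[F]_(m, p)) :
  cd_mulmx A (X - Y) = cd_mulmx A X - cd_mulmx A Y.
Proof.
apply/matrixP => i j; rewrite !mxE -sumrB; apply: eq_bigr => l _.
by rewrite !mxE cd_mulDr cd_mulNr.
Qed.

Lemma cd_mulmxD n m p (A : 'M[F]_(n, m)) (X Y : 'M[F]_(m, p)) :
  cd_mulmx A (X + Y) = cd_mulmx A X + cd_mulmx A Y.
Proof.
apply/matrixP => i j; rewrite !mxE -big_split; apply: eq_bigr => l _.
by rewrite !mxE cd_mulDr.
Qed.

Lemma cd_mulmxZ n m p (A : 'M[F]_(n, m)) r (X : 'M[F]_(m, p)) :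
  cd_mulmx A (rscalemx r X) = rscalemx r (cd_mulmx A X).
Proof.
apply/matrixP => i j; rewrite !mxE scaler_sumr; apply: eq_bigr => l _.
by rewrite !mxE cd_mulZr.
Qed.

Lemma cd_mulmxA n m p q (A : 'M[F]_(n, m)) (B : 'M[F]_(m, p)) (C : 'M[F]_(p, q)) :
  (k <= 2)%N -> cd_mulmx A (cd_mulmx B C) = cd_mulmx (cd_mulmx A B) C.
Proof.
move=> k2; apply/matrixP => i j; rewrite !mxE.
under eq_bigr do rewrite mxE cd_mul_sumr.
rewrite exchange_big; apply: eq_bigr => l _ /=.
by rewrite mxE cd_mul_suml; apply: eq_bigr => h _; rewrite cd_mulA.
Qed.

Lemma cd_adjK n m : cancel (@cd_adj R k n m) (@cd_adj R k m n).
Proof. by move=> A; apply/matrixP => i j; rewrite !mxE cd_conjK. Qed.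

Definition vdot n (u v : 'cV[F]_n) : R := \sum_i cd_dot (u i 0) (v i 0).

Lemma vdotC n (u v : 'cV[F]_n) : vdot u v = vdot v u.
Proof. by apply: eq_bigr => i _; rewrite cd_dotC. Qed.

Lemma vdotE n (u : 'cV[F]_n) : vdot u u = mxnormsq u.
Proof. by apply: eq_bigr => i _; rewrite big_ord1 cd_normsqE. Qed.

Lemma vdotZl n r (u v : 'cV[F]_n) : vdot (rscalemx r u) v = r * vdot u v.
Proof. by rewrite mulr_sumr; apply: eq_bigr => i _; rewrite mxE cd_dotZl. Qed.

Lemma vdotZr n r (u v : 'cV[F]_n) : vdot u (rscalemx r v) = r * vdot u v.
Proof. by rewrite vdotC vdotZl vdotC. Qed.

Lemma vdot_adj n m (A : 'M[F]_(n, m)) (v : 'cV[F]_m) (u : 'cV[F]_n) :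
  vdot (cd_mulmx A v) u = vdot v (cd_mulmx (cd_adj A) u).
Proof.
rewrite /vdot; under eq_bigr do rewrite mxE cd_dot_suml.
rewrite exchange_big; apply: eq_bigr => j _ /=.
by rewrite mxE cd_dot_sumr; apply: eq_bigr => i _; rewrite cd_dot_mull mxE.
Qed.

(** When [F] is associative, vanishing of this [F]-valued product makes the columns orthogonal even
    after multiplication by arbitrary scalars, as [mxnormsq_mulmx] requires. Vanishing of the real
    number [vdot u v] does not suffice in general. *)
Definition hdot n (u v : 'cV[F]_n) : F := \sum_i cd_mul (cd_conj (u i 0)) (v i 0).

Lemma hdot_adj n m (A : 'M[F]_(n, m)) (v : 'cV[F]_m) (u : 'cV[F]_n) : (k <= 2)%N ->
  hdot (cd_mulmx A v) u = hdot v (cd_mulmx (cd_adj A) u).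
Proof.
move=> k2; rewrite /hdot; under eq_bigr do rewrite mxE cd_conj_sum cd_mul_suml.
rewrite exchange_big; apply: eq_bigr => j _ /=.
rewrite mxE cd_mul_sumr; apply: eq_bigr => i _.
by rewrite mxE cd_conjM cd_mulA.
Qed.

Lemma hdotZl n r (u v : 'cV[F]_n) : hdot (rscalemx r u) v = r *: hdot u v.
Proof. by rewrite scaler_sumr; apply: eq_bigr => i _; rewrite mxE cd_conjZ cd_mulZl. Qed.

Lemma hdotZr n r (u v : 'cV[F]_n) : hdot u (rscalemx r v) = r *: hdot u v.
Proof. by rewrite scaler_sumr; apply: eq_bigr => i _; rewrite mxE cd_mulZr. Qed.

(** In the expansion of the squared norm the diagonal terms simplify by the composition law. The
    condition on cross terms keeps the scalars [x] and [y] inside, because pulling them out takes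
    associativity. *)
Lemma mxnormsq_mulmx p n m (V : 'M[F]_(p, n)) (Z : 'M[F]_(n, m)) : (k <= 3)%N ->
  (forall i, \sum_a cd_normsq (V a i) = 1) ->
  (forall i j x y, i != j ->
    \sum_a cd_dot (cd_mul (V a i) x) (cd_mul (V a j) y) = 0) ->
  mxnormsq (cd_mulmx V Z) = mxnormsq Z.
Proof.
move=> k3 V1 V0; rewrite /mxnormsq exchange_big [RHS]exchange_big.
apply: eq_bigr => j _ /=.
under eq_bigr => a _.
  rewrite mxE cd_normsqE cd_dot_suml; under eq_bigr do rewrite cd_dot_sumr.
  over.
rewrite exchange_big; apply: eq_bigr => i _ /=.
rewrite exchange_big (bigD1 i)//= [X in _ + X]big1 ?addr0; last first.
  by move=> l li; rewrite V0// eq_sym.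
under eq_bigr do rewrite cd_dot_mulM// -cd_normsqE.
by rewrite -mulr_suml V1 mul1r.
Qed.

Definition rowscale (s : nat -> R) n m (Z : 'M[F]_(n, m)) : 'M[F]_(n, m) :=
  \matrix_(i, j) (s i *: Z i j).

Lemma sigma_in n p (A : 'M[F]_(p, n)) i : frakL n p n A -> (i < n)%N ->
  singular_values A (sigma A i).
Proof. by move=> [_ An] iN; exact: ith_largest_in An iN. Qed.

Lemma sigma_gt0 n p (A : 'M[F]_(p, n)) i : frakL n p n A -> (i < n)%N ->
  0 < sigma A i.
Proof. by move=> An /(sigma_in An)[]. Qed.

(* V and U collect right and left singular vectors. *)
Definition svd n p m (A : 'M[F]_(p, n)) (U : 'M[F]_(p, n)) (V : 'M[F]_n) : Prop :=
  [/\ forall Z : 'M[F]_(n, m),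
        cd_mulmx A (cd_mulmx V Z) = cd_mulmx U (rowscale (sigma A) Z),
      forall Z : 'M[F]_(n, m), mxnormsq (cd_mulmx U Z) = mxnormsq Z
    & forall Z : 'M[F]_(n, m), mxnormsq (cd_mulmx V Z) = mxnormsq Z].

(** There are as many distinct singular values as columns, so one pair of vectors for each already
    fills [V]. Distinctness makes these vectors orthogonal, and no basis has to be completed. *)
Lemma exists_svd_assoc n p m (A : 'M[F]_(p, n)) : (k <= 2)%N -> frakL n p n A ->
  exists U V, svd m A U V.
Proof.
move=> k2 hA.
have /choice[uv uvP] : forall i : 'I_n, exists uv : 'cV[F]_p * 'cV[F]_n,
    [/\ uv.1 != 0, uv.2 != 0, cd_mulmx A uv.2 = rscalemx (sigma A i) uv.1
      & cd_mulmx (cd_adj A) uv.1 = rscalemx (sigma A i) uv.2].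
  by move=> i; have [_ [u [v uvP]]] := sigma_in hA (ltn_ord i); exists (u, v).
pose u i := (uv i).1; pose v i := (uv i).2; pose s (i : 'I_n) := sigma A i.
have s0 i : 0 < s i := sigma_gt0 hA (ltn_ord i).
have Av i : cd_mulmx A (v i) = rscalemx (s i) (u i) by have [] := uvP i.
have Au i : cd_mulmx (cd_adj A) (u i) = rscalemx (s i) (v i) by have [] := uvP i.
have nuv i : mxnormsq (u i) = mxnormsq (v i).
  apply: (@mulfI _ (s i)); first by rewrite gt_eqF.
  by rewrite -!vdotE -vdotZl -Av vdot_adj Au vdotZr.
have nv0 i : 0 < mxnormsq (v i).
  by rewrite lt_neqAle mxnormsq_ge0 eq_sym mxnormsq_eq0 andbT; have [] := uvP i.
(* Moving [A] across the product from either side gives two relations between the products of the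
   [u] and those of the [v]. Eliminating the latter leaves the factor [s i ^+ 2 - s j ^+ 2]. *)
have huv i j : s i *: hdot (u i) (u j) = s j *: hdot (v i) (v j).
  by rewrite -hdotZl -Av hdot_adj// Au hdotZr.
have hvu i j : s j *: hdot (u i) (u j) = s i *: hdot (v i) (v j).
  by rewrite -hdotZr -Av -hdotZl -Au hdot_adj// cd_adjK.
have hu0 i j : i != j -> hdot (u i) (u j) = 0.
  move=> ij; have : (s i ^+ 2 - s j ^+ 2) *: hdot (u i) (u j) = 0.
    by rewrite scalerBl !expr2 -!scalerA huv hvu !scalerA mulrC subrr.
  move/eqP; rewrite scaler_eq0 => /orP[|/eqP//].
  rewrite subr_eq0 eqrXn2 ?(ltW (s0 _))// => /eqP sij.
  have := ith_largest_inj hA.2 (ltn_ord i) (ltn_ord j) sij.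
  by move=> /val_inj; move/eqP: ij.
have hv0 i j : i != j -> hdot (v i) (v j) = 0.
  move=> ij; have := huv i j; rewrite hu0// scaler0 => /esym/eqP.
  by rewrite scaler_eq0 gt_eqF//= => /eqP.
(* By [nuv] one factor normalizes both [u i] and [v i]. *)
pose c i := (Num.sqrt (mxnormsq (v i)))^-1.
have c2 i : c i ^+ 2 * mxnormsq (v i) = 1.
  by rewrite exprVn sqr_sqrtr ?mxnormsq_ge0// mulVf// gt_eqF.
have iso q (w : 'I_n -> 'cV[F]_q) (Z : 'M[F]_(n, m)) :
    (forall i, mxnormsq (w i) = mxnormsq (v i)) ->
    (forall i j, i != j -> hdot (w i) (w j) = 0) ->
    mxnormsq (cd_mulmx (\matrix_(a, i) (c i *: w i a 0)) Z) = mxnormsq Z.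
  move=> wn w0; apply: mxnormsq_mulmx => [|i|i j x y ij]; first exact: leqW.
    rewrite -(c2 i) -wn mulr_sumr; apply: eq_bigr => a _.
    by rewrite mxE cd_normsqZ big_ord1.
  transitivity (cd_dot x (cd_mul ((c i * c j) *: hdot (w i) (w j)) y)); last first.
    by rewrite w0// scaler0 cd_mul0l cd_dotC cd_dot0l.
  rewrite cd_mulZl cd_dotZr cd_mul_suml cd_dot_sumr mulr_sumr.
  apply: eq_bigr => a _; rewrite !mxE !cd_mulZl cd_dotZl cd_dotZr mulrA.
  by rewrite cd_dot_mull cd_mulA.
exists (\matrix_(a, i) (c i *: u i a 0)), (\matrix_(a, i) (c i *: v i a 0)).
split=> Z; [|by apply: iso|by apply: iso].
rewrite cd_mulmxA//; apply/matrixP => a j; rewrite !mxE; apply: eq_bigr => i _.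
have := congr1 (fun M : 'cV[F]_p => M a 0) (Av i); rewrite !mxE => Ai.
rewrite (_ : \sum_(l < n) _ = c i *: (s i *: u i a 0)); last first.
  rewrite -Ai scaler_sumr; apply: eq_bigr => l _.
  by rewrite !mxE cd_mulZr.
by rewrite !cd_mulZl cd_mulZr.
Qed.

(** With a single column [v] has one entry, and by [cd_conj_mulK] multiplying by [A] and then by
    [cd_adj A] multiplies that entry by [mxnormsq A]. *)
Lemma singular_value_col p (A : 'M[F]_(p, 1)) s : (k <= 3)%N ->
  singular_values A s -> s ^+ 2 = mxnormsq A.
Proof.
move=> k3 [s0 [u [v [_ v0 Av Au]]]].
have : (mxnormsq A - s ^+ 2) *: v 0 0 = 0.
  have -> : (mxnormsq A - s ^+ 2) *: v 0 0 =
      \sum_i cd_mul (cd_conj (A i 0)) (cd_mul (A i 0) (v 0 0)) - s *: (s *: v 0 0).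
    under eq_bigr do rewrite cd_conj_mulK//.
    rewrite -scaler_suml scalerBl scalerA -expr2; congr (_ *: _ - _).
    by apply: eq_bigr => i _; rewrite big_ord1.
  have := congr1 (fun M : 'cV[F]_1 => M 0 0) Au; rewrite !mxE => <-.
  rewrite scaler_sumr -sumrB big1// => i _.
  have := congr1 (fun M : 'cV[F]_p => M i 0) Av; rewrite !mxE big_ord1 => ->.
  by rewrite cd_mulZr subrr.
move/eqP; rewrite scaler_eq0 subr_eq0 => /orP[/eqP->//|].
move=> /eqP v00; case/eqP: v0; apply/matrixP => i j.
by rewrite !ord1 mxE v00.
Qed.

(** With at most one column there are no cross terms: [U] is [A] divided by its norm and [V] is the
    identity matrix. *)
Lemma exists_svd_col n p m (A : 'M[F]_(p, n)) : (k <= 3)%N -> (n <= 1)%N ->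
  frakL n p n A -> (exists e : F, forall x, cd_mul e x = x) -> exists U V, svd m A U V.
Proof.
move=> k3 n1 hA [e eK].
have ordE (i j : 'I_n) : i = j.
  have z (l : 'I_n) : val l = 0%N.
    by apply/eqP; rewrite -leqn0 -ltnS (leq_trans (ltn_ord l)).
  by apply: val_inj; rewrite !z.
have N2 (i : 'I_n) : sigma A i ^+ 2 = \sum_a cd_normsq (A a i).
  move: A hA i {ordE}; move: n1; case: n => [|[|//]] _ A hA i; first by case: i.
  rewrite (singular_value_col k3 (sigma_in hA (ltn_ord i))).
  by apply: eq_bigr => a _; rewrite big_ord1 (ord1 i).
exists (\matrix_(a, i) ((sigma A i)^-1 *: A a i)), (\matrix_(a, i) e).
have VZ (Z : 'M[F]_(n, m)) : cd_mulmx (\matrix_(a, i) e) Z = Z.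
  apply/matrixP => i j; rewrite mxE (bigD1 i)//= big1 ?addr0 ?mxE ?eK//.
  by move=> l; rewrite (ordE l i) eqxx.
split=> Z; rewrite ?VZ//.
  apply/matrixP => a j; rewrite !mxE; apply: eq_bigr => i _.
  rewrite !mxE cd_mulZl cd_mulZr scalerA mulVf ?scale1r// gt_eqF//.
  exact: sigma_gt0.
apply: mxnormsq_mulmx => // [i|i j x y]; last by rewrite (ordE i j) eqxx.
under eq_bigr do rewrite mxE cd_normsqZ.
rewrite -mulr_sumr -N2 -exprMn mulVf ?expr1n// gt_eqF//.
exact: sigma_gt0.
Qed.

End vectors.

(** * Volume on matrices *)

Section open_measurable.
Context (R : realType) (I : finType).

(* U is the union of the cubes of the grids of mesh 1 / (N + 1) that it contains. *)
Lemma measurable_coord_open (U : set (bcoords R I)) :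
  (forall x, U x -> exists2 e : R, 0 < e &
    forall y : coords R I, (forall i, `|y i - x i| < e) -> U y) ->
  measurable U.
Proof.
move=> Uopen.
pose cube (q : nat * {ffun I -> int}) : set (bcoords R I) :=
  box (fun i => (q.2 i)%:~R / q.1.+1%:R) (fun i => (q.2 i + 1)%:~R / q.1.+1%:R).
(* [unpickle] runs through the countably many grid cubes. Codes of no cube, or of a cube not inside
   [U], contribute the empty set. *)
pose C j : set (bcoords R I) :=
  if choice.unpickle j is Some q then
    if `[< cube q `<=` U >] then cube q else set0
  else set0.
have -> : U = \bigcup_j C j.
  apply/seteqP; split=> [x Ux|x [j _]]; last first.
    by rewrite /C; case: choice.unpickle => [q|//]; case: asboolP => // qU; exact: qU.
  have [e e0 xU] := Uopen x Ux.
  have [N Ne] : exists N, N.+1%:R^-1 < e.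
    by have [N] := ltr_add_invr e0; rewrite add0r; exists N.
  have N0 : (0 : R) < N.+1%:R by [].
  pose q : nat * {ffun I -> int} := (N, [ffun i => Num.floor (x i * N.+1%:R)]).
  have qx : cube q x.
    move=> i; rewrite /q/= ffunE ler_pdivrMr// ltr_pdivlMr//.
    by rewrite floor_le_tmp floorD1_gt.
  exists (choice.pickle q) => //; rewrite /C choice.pickleK asboolT// => y qy.
  apply: xU => i; apply: le_lt_trans Ne.
  have /andP[x1 x2] := qx i; have /andP[y1 y2] := qy i.
  move: x1 x2 y1 y2; rewrite /= intrD mulr1z mulrDl mul1r => x1 x2 y1 y2.
  have close (u v a b : R) : u <= a -> a < u + v -> u <= b -> b < u + v ->
      `|b - a| <= v.
    by move=> *; rewrite ler_norml; apply/andP; split; lra.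
  exact: close x1 x2 y1 y2.
apply: bigcup_measurable => j _; rewrite /C.
case: choice.unpickle => [q|]; last exact: measurable0.
by case: ifP => _; [exact: measurable_box|exact: measurable0].
Qed.

Lemma linear_coord_sum (f : coords R I -> R) :
  (forall x y, f (fun i => x i + y i) = f x + f y) ->
  (forall r x, f (fun i => r * x i) = r * f x) ->
  forall x, f x = \sum_i x i * f (fun j => (i == j)%:R).
Proof.
move=> fD fZ x.
pose delta i : coords R I := fun j => (i == j)%:R.
have f0 : f (fun=> 0) = 0.
  rewrite -[RHS](mul0r (f (fun=> 0))) -fZ.
  by congr f; apply/funext => i; rewrite mul0r.
have fsum (s : seq I) :
    f (fun j => \sum_(i <- s) x i * delta i j) = \sum_(i <- s) x i * f (delta i).
  elim: s => [|i s IH].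
    by rewrite big_nil -f0; congr f; apply/funext => j; rewrite big_nil.
  by rewrite big_cons -IH -fZ -fD; congr f; apply/funext => j; rewrite big_cons.
rewrite -big_enum -fsum; congr f; apply/funext => j.
rewrite big_enum/= (bigD1 j)//= big1 ?addr0 /delta ?eqxx ?mulr1//.
by move=> i /negbTE ->; rewrite mulr0.
Qed.

Lemma measurable_linear (f : coords R I -> R) :
  (forall x y, f (fun i => x i + y i) = f x + f y) ->
  (forall r x, f (fun i => r * x i) = r * f x) ->
  measurable_fun [set: bcoords R I] (f : bcoords R I -> R).
Proof.
move=> fD fZ; rewrite (_ : f = fun x => \sum_i x i * f (fun j => (i == j)%:R)).
  apply: measurable_sum => i; apply: measurable_funM => //; exact: measurable_coord.
by apply/funext => x; exact: linear_coord_sum.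
Qed.

End open_measurable.

Section matrix_coords.
Context (R : realType).

(** The index type follows the doubling, so coordinates are defined by the same recursion as [cd]
    and need no index arithmetic. *)
Fixpoint cd_index (k : nat) : finType :=
  match k with
  | 0 => unit
  | k'.+1 => (cd_index k' + cd_index k')%type
  end.

Lemma card_cd_index k : #|cd_index k| = (2 ^ k)%N.
Proof. by elim: k => [|k IH]; rewrite ?card_unit//= card_sum IH addnn -mul2n -expnS. Qed.

Fixpoint cd_coord (k : nat) : cd R k -> cd_index k -> R :=
  match k with
  | 0 => fun x _ => x
  | k'.+1 => fun x i =>
      match i with inl j => cd_coord x.1 j | inr j => cd_coord x.2 j end
  end.

Fixpoint cd_of_coord (k : nat) : (cd_index k -> R) -> cd R k :=
  match k with
  | 0 => fun x => x tt
  | k'.+1 => fun x => (cd_of_coord (fun j => x (inl j)), cd_of_coord (fun j => x (inr j)))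
  end.

Lemma cd_of_coordK k (x : cd_index k -> R) : cd_coord (cd_of_coord x) = x.
Proof.
apply/funext; elim: k x => [|k IH] x /=; first by case.
by case=> j; rewrite IH.
Qed.

Lemma cd_coordK k (x : cd R k) : cd_of_coord (cd_coord x) = x.
Proof. by elim: k x => //= k IH [a b]; rewrite !IH. Qed.

Lemma cd_coordD k (x y : cd R k) i : cd_coord (x + y) i = cd_coord x i + cd_coord y i.
Proof. by elim: k x y i => [//|k IH] x y [] i /=; rewrite IH. Qed.

Lemma cd_coordZ k r (x : cd R k) i : cd_coord (r *: x) i = r * cd_coord x i.
Proof. by elim: k x i => [//|k IH] x [] i /=; rewrite IH. Qed.

Lemma cd_coord0 k i : cd_coord (0 : cd R k) i = 0.
Proof. by have := cd_coordZ 0 (0 : cd R k) i; rewrite scale0r mul0r. Qed.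

Lemma cd_coordB k (x y : cd R k) i : cd_coord (x - y) i = cd_coord x i - cd_coord y i.
Proof. by rewrite cd_coordD -scaleN1r cd_coordZ mulN1r. Qed.

Lemma cd_dot_coord k (x y : cd R k) : cd_dot x y = \sum_i cd_coord x i * cd_coord y i.
Proof.
elim: k x y => [|k IH] x y /=; first by rewrite big_const card_unit/= addr0.
by rewrite big_sumType !IH.
Qed.

Lemma cd_normsq_coord k (x : cd R k) : cd_normsq x = \sum_i cd_coord x i ^+ 2.
Proof. by rewrite cd_normsqE cd_dot_coord. Qed.

(** The norm of [cd R k] is the sup norm of the real coordinates. This links the topology behind
    [borel] to boxes. *)
Lemma cd_norm_lt k (x : cd R k) e : 0 < e -> (forall i, `|cd_coord x i| < e) -> `|x| < e.
Proof.
move=> e0; elim: k x => [|k IH] x xe; first exact: (xe tt).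
rewrite /= prod_normE gt_max; apply/andP; split.
  by apply: IH => i; exact: (xe (inl i)).
by apply: IH => i; exact: (xe (inr i)).
Qed.

Variables (k n m : nat).
Local Notation F := (cd R k).

Definition mx_index : finType := ('I_n * 'I_m * cd_index k)%type.

Lemma card_mx_index : #|mx_index| = (n * m * 2 ^ k)%N.
Proof. by rewrite !card_prod !card_ord card_cd_index. Qed.

Definition mx_coord (X : 'M[F]_(n, m)) : coords R mx_index :=
  fun i => cd_coord (X i.1.1 i.1.2) i.2.

Definition mx_of_coord (x : coords R mx_index) : 'M[F]_(n, m) :=
  \matrix_(i, j) cd_of_coord (fun l => x (i, j, l)).

Lemma mx_coordK : cancel mx_coord mx_of_coord.
Proof. by move=> X; apply/matrixP => i j; rewrite mxE; exact: (cd_coordK (X i j)). Qed.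

Lemma mx_of_coordK : cancel mx_of_coord mx_coord.
Proof. by move=> x; apply/funext => -[[i j] l]; rewrite /mx_coord mxE cd_of_coordK. Qed.

Lemma mxdistE (X Y : 'M[F]_(n, m)) : mxdist X Y = Num.sqrt (mxnormsq (X - Y)).
Proof. by []. Qed.

Lemma mxdist_coord (X Y : 'M[F]_(n, m)) :
  euclid (mx_coord X) (mx_coord Y) = mxdist X Y.
Proof.
rewrite /euclid mxdistE; congr Num.sqrt; rewrite /mxnormsq pair_big/=.
rewrite (eq_bigr (fun p : 'I_n * 'I_m =>
  \sum_l cd_coord ((X - Y) p.1 p.2) l ^+ 2)); last first.
  by move=> p _; rewrite cd_normsq_coord.
rewrite pair_big/=; apply: eq_bigr => -[[i j] l] _ /=.
by rewrite !mxE cd_coordB.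
Qed.

Lemma mxdist_ge0 (X Y : 'M[F]_(n, m)) : 0 <= mxdist X Y.
Proof. exact: sqrtr_ge0. Qed.

Lemma vol_coord (E : set 'M[F]_(n, m)) :
  vol (n * m * 2 ^ k) E = @hmeas R mx_index (mx_coord @` E).
Proof.
rewrite /hmeas card_mx_index; apply/esym/hausdorff_isometry.
- exact: mxdist_ge0.
- exact: euclid_ge0.
- exact: can_inj mx_coordK.
- by move=> X Y _ _; exact: mxdist_coord.
Qed.

Lemma image_mx_coord (E : set 'M[F]_(n, m)) : mx_coord @` E = mx_of_coord @^-1` E.
Proof.
apply/seteqP; split=> [_ [X EX <-]|x Ex]; first by rewrite /= mx_coordK.
by exists (mx_of_coord x) => //; rewrite mx_of_coordK.
Qed.

Lemma measurable_borel (E : set 'M[F]_(n, m)) : borel E ->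
  measurable (mx_of_coord @^-1` E : set (bcoords R mx_index)).
Proof.
apply: (@smallest_sub _ (sigma_algebra setT) _
  [set E | measurable (mx_of_coord @^-1` E : set (bcoords R mx_index))]).
  split=> /=.
  - by rewrite preimage_set0; exact: measurable0.
  - by move=> A mA; rewrite setTD preimage_setC; exact: measurableC.
  - by move=> A mA; rewrite preimage_bigcup; exact: bigcupT_measurable.
move=> U oU /=; apply: measurable_coord_open => x Ux.
have : nbhs (mx_of_coord x) U by move: oU; rewrite openE => /(_ _ Ux).
move=> [P nP PU].
have /choice[e eP] : forall ij : 'I_n * 'I_m, exists e : R, 0 < e /\
    forall z, `|mx_of_coord x ij.1 ij.2 - z| < e -> P ij.1 ij.2 z.
  move=> ij; have /nbhs_ballP[e /= e0 eB] := nP ij.1 ij.2.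
  by exists e; split=> // z xz; apply: eB; rewrite -ball_normE.
exists (\big[Num.min/1]_ij e ij).
  by elim/big_ind: _ => // [a b a0 b0|ij _]; [rewrite lt_min a0|case: (eP ij)].
move=> y yx /=; apply: PU => i j; apply: (eP (i, j)).2.
apply: cd_norm_lt => [|l]; first by case: (eP (i, j)).
rewrite !mxE cd_coordB !cd_of_coordK distrC; apply: lt_le_trans (yx _) _.
exact: bigmin_le_cond.
Qed.

End matrix_coords.

Arguments mx_coord {R k n m} X.
Arguments mx_of_coord {R k n m} x.

(** * Real-linear maps in coordinates *)

Section linear_matrix.
Context (R : realType) (I J : finType).

Definition coord_row (x : coords R I) : 'rV[R]_#|I| := \row_j x (enum_val j).

Lemma coord_row_inj : injective coord_row.
Proof.
move=> x y /rowP xy; apply/funext => i.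
by have := xy (enum_rank i); rewrite !mxE enum_rankK.
Qed.

Lemma coord_row_surj r : exists x, coord_row x = r.
Proof.
exists (fun i => r 0 (enum_rank i)); apply/rowP => j.
by rewrite !mxE enum_valK.
Qed.

Definition lin_coord_mx (L : coords R I -> coords R J) : 'M[R]_(#|I|, #|J|) :=
  \matrix_(i, j) L (fun l => (enum_val i == l)%:R) (enum_val j).

End linear_matrix.

Lemma lin_coord_mxE (R : realType) (I J : finType) (L : coords R I -> coords R J) :
  (forall x y, L (fun i => x i + y i) = fun j => L x j + L y j) ->
  (forall r x, L (fun i => r * x i) = fun j => r * L x j) ->
  forall x, coord_row (L x) = coord_row x *m lin_coord_mx L.
Proof.
move=> LD LZ x; apply/rowP => j; rewrite !mxE.
rewrite (@linear_coord_sum _ _ (fun x => L x (enum_val j))).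
- by rewrite (reindex_onto enum_val enum_rank)/= => [|i _];
    [apply: eq_big => i; rewrite ?enum_valK ?eqxx// !mxE|rewrite enum_rankK].
- by move=> y z; rewrite LD.
- by move=> r y; rewrite LZ.
Qed.

Lemma row_free_ker (F : fieldType) (n : nat) (M : 'M[F]_n) :
  (forall r : 'rV_n, r *m M = 0 -> r = 0) -> M \in unitmx.
Proof.
move=> ker0; rewrite -row_free_unit -kermx_eq0; apply/rowV0P => v /sub_kermxP.
exact: ker0.
Qed.

Lemma linear_coord_surj (R : realType) (I : finType) (L : coords R I -> coords R I) :
  (forall x y, L (fun i => x i + y i) = fun j => L x j + L y j) ->
  (forall r x, L (fun i => r * x i) = fun j => r * L x j) ->
  injective L -> forall y, exists x, L x = y.
Proof.
move=> LD LZ Linj y.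
have unitL : lin_coord_mx L \in unitmx.
  apply: row_free_ker => r; have [x <-] := coord_row_surj r.
  rewrite -lin_coord_mxE// => Lx0.
  have L0 : L (fun=> 0) = fun=> 0.
    have := LZ 0 (fun=> 0); rewrite (_ : (fun i : I => 0 * 0) = fun=> 0 :> R).
      by move=> ->; apply/funext => i; rewrite mul0r.
    by apply/funext => i; rewrite mul0r.
  have row0 : coord_row (fun=> 0 : R) = 0 :> 'rV[R]_#|I| by apply/rowP => i; rewrite !mxE.
  rewrite -row0; congr coord_row; apply: Linj; rewrite L0.
  by apply: coord_row_inj; rewrite row0.
have [x xE] := coord_row_surj (coord_row y *m invmx (lin_coord_mx L)).
by exists x; apply: coord_row_inj; rewrite lin_coord_mxE// xE mulmxKV.
Qed.

(** * Volume under a singular value decomposition *)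

Section volume_svd.
Context (R : realType) (k : nat).
Local Notation F := (cd R k).

Lemma mx_coordD n m (X Y : 'M[F]_(n, m)) :
  mx_coord (X + Y) = fun i => mx_coord X i + mx_coord Y i.
Proof. by apply/funext => i; rewrite /mx_coord mxE cd_coordD. Qed.

Lemma mx_coordZ n m r (X : 'M[F]_(n, m)) :
  mx_coord (rscalemx r X) = fun i => r * mx_coord X i.
Proof. by apply/funext => i; rewrite /mx_coord mxE cd_coordZ. Qed.

Lemma mx_of_coordD n m (x y : coords R (mx_index k n m)) :
  mx_of_coord (fun i => x i + y i) = mx_of_coord x + mx_of_coord y.
Proof.
apply: (can_inj (@mx_coordK R k n m)).
by rewrite mx_coordD !mx_of_coordK.
Qed.

Lemma mx_of_coordZ n m r (x : coords R (mx_index k n m)) :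
  mx_of_coord (fun i => r * x i) = rscalemx r (mx_of_coord x).
Proof.
apply: (can_inj (@mx_coordK R k n m)).
by rewrite mx_coordZ !mx_of_coordK.
Qed.

Lemma mulmx_isometry_inj n p m (U : 'M[F]_(p, n)) :
  (forall Z : 'M[F]_(n, m), mxnormsq (cd_mulmx U Z) = mxnormsq Z) ->
  injective (fun Z : 'M[F]_(n, m) => cd_mulmx U Z).
Proof.
move=> Uiso X Y UXY; apply/eqP; rewrite -subr_eq0 -mxnormsq_eq0 -Uiso cd_mulmxB.
by rewrite UXY subrr mxnormsq_eq0.
Qed.

Lemma vol_isometry n p m (U : 'M[F]_(p, n)) (d : nat) (E : set 'M[F]_(n, m)) :
  (forall Z : 'M[F]_(n, m), mxnormsq (cd_mulmx U Z) = mxnormsq Z) ->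
  vol d (cd_mulmx U @` E) = vol d E.
Proof.
move=> Uiso; apply: hausdorff_isometry.
- exact: mxdist_ge0.
- exact: mxdist_ge0.
- exact: mulmx_isometry_inj.
- by move=> X Y _ _; rewrite !mxdistE -cd_mulmxB Uiso.
Qed.

(** Injectivity gives surjectivity by a real dimension count, with no inverse matrix over [F]. This
    is what allows [E] to be written as an image under [V]. *)
Lemma mulmx_isometry_surj n m (V : 'M[F]_n) :
  (forall Z : 'M[F]_(n, m), mxnormsq (cd_mulmx V Z) = mxnormsq Z) ->
  forall X : 'M[F]_(n, m), exists Z, cd_mulmx V Z = X.
Proof.
move=> Viso X.
pose L (x : coords R (mx_index k n m)) := mx_coord (cd_mulmx V (mx_of_coord x)).
have [|||x Lx] := @linear_coord_surj R _ L _ _ _ (mx_coord X).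
- by move=> x y; rewrite /L mx_of_coordD cd_mulmxD mx_coordD.
- by move=> r x; rewrite /L mx_of_coordZ cd_mulmxZ mx_coordZ.
- move=> x y /(can_inj (@mx_coordK _ _ _ _))/(mulmx_isometry_inj Viso).
  exact: (can_inj (@mx_of_coordK _ _ _ _)).
- by exists (mx_of_coord x); apply: (can_inj (@mx_coordK _ _ _ _)).
Qed.

Lemma measurable_mulmx_preimage n p m (V : 'M[F]_(p, n)) (E : set 'M[F]_(p, m)) :
  borel E -> measurable (mx_of_coord @^-1` [set Z : 'M[F]_(n, m) | E (cd_mulmx V Z)]
    : set (bcoords R (mx_index k n m))).
Proof.
move=> /measurable_borel mE.
pose L (x : bcoords R (mx_index k n m)) : bcoords R (mx_index k p m) :=
  mx_coord (cd_mulmx V (mx_of_coord x)).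
rewrite (_ : _ @^-1` _ = L @^-1` (mx_of_coord @^-1` E)); last first.
  by apply/seteqP; split=> x; rewrite /= mx_coordK.
rewrite -[X in measurable X]setTI; apply: measurable_fun_coords => // i.
apply: measurable_linear => [x y|r x].
  by rewrite /L mx_of_coordD cd_mulmxD mx_coordD.
by rewrite /L mx_of_coordZ cd_mulmxZ mx_coordZ.
Qed.

(** The origin of the exponent: each row has [m] entries with [2 ^ k] real coordinates each. *)
Lemma prod_mx_index n m (s : nat -> R) :
  \prod_(i : mx_index k n m) s i.1.1 = \prod_(i < n) s i ^+ (2 ^ k * m).
Proof.
transitivity (\prod_(i < n) \prod_(j < m) \prod_(l : cd_index k) s i).
  rewrite pair_big/= pair_big/=; apply: eq_bigr => -[[i j] l] _ //.
apply: eq_bigr => i _.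
have -> : \prod_(l : cd_index k) s i = s i ^+ (2 ^ k).
  by rewrite -card_cd_index; exact: prodr_const.
by rewrite exprM -[in RHS](card_ord m); exact: prodr_const.
Qed.

Lemma vol_rowscale n m (s : nat -> R) (E : set 'M[F]_(n, m)) :
  (forall i, (i < n)%N -> 0 < s i) ->
  measurable (mx_of_coord @^-1` E : set (bcoords R (mx_index k n m))) ->
  vol (n * m * 2 ^ k) (@rowscale R k s n m @` E) =
  ((\prod_(i < n) s i ^+ (2 ^ k * m))%:E * vol (n * m * 2 ^ k) E)%E.
Proof.
move=> s0 mE; rewrite !vol_coord image_comp.
have -> : (mx_coord \o @rowscale R k s n m) @` E =
    (fun (x : coords R (mx_index k n m)) (i : mx_index k n m) => s i.1.1 * x i) @`
      (mx_coord @` E).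
  rewrite [RHS]image_comp; apply: eq_imagel => X _ /=.
  by apply/funext => i; rewrite /mx_coord mxE cd_coordZ.
by rewrite image_mx_coord hmeas_diag ?prod_mx_index// => i; exact: s0.
Qed.

Lemma vol_svd n p m (A U : 'M[F]_(p, n)) (V : 'M[F]_n) (E : set 'M[F]_(n, m)) :
  svd m A U V -> (forall i, (i < n)%N -> 0 < sigma A i) -> borel E ->
  vol (n * m * 2 ^ k) (cd_mulmx A @` E) =
  ((\prod_(i < n) sigma A i ^+ (2 ^ k * m))%:E * vol (n * m * 2 ^ k) E)%E.
Proof.
move=> [AVU Uiso Viso] s0 bE.
pose E' := [set Z : 'M[F]_(n, m) | E (cd_mulmx V Z)].
have EE' : cd_mulmx V @` E' = E.
  apply/seteqP; split=> [_ [Z EZ <-]//|X EX].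
  by have [Z ZX] := mulmx_isometry_surj Viso X; exists Z; rewrite /E' /= ZX.
have -> : cd_mulmx A @` E = cd_mulmx U @` (@rowscale R k (sigma A) n m @` E').
  rewrite -[in LHS]EE' [LHS]image_comp [RHS]image_comp.
  by apply: eq_imagel => Z _ /=; exact: AVU.
rewrite vol_isometry// vol_rowscale//; last exact: measurable_mulmx_preimage.
by rewrite -[in RHS]EE' vol_isometry.
Qed.

End volume_svd.

Lemma finite_roots (R : realType) (p : {poly R}) : p != 0 ->
  finite_set [set x | root p x].
Proof.
move=> p0; apply: contrapT => /(infinite_set_fset (size p))[B Broot szB].
have := @max_poly_roots _ p (enum_fset B) p0.
rewrite fset_uniq => /(_ _ isT); rewrite ltnNge szB => /implyP.
rewrite implybF => /negP; apply.
by apply/allP => x xB; exact: Broot.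
Qed.

(** * Eigenvalues of the Gram matrix and singular values *)

Section lambda_sigma.
Context (R : realType) (k : nat).
Local Notation F := (cd R k).

Lemma rscalemx_comp n m r s (X : 'M[F]_(n, m)) :
  rscalemx r (rscalemx s X) = rscalemx (r * s) X.
Proof. by apply/matrixP => i j; rewrite !mxE scalerA. Qed.

Lemma rscalemx_eq0 n m r (X : 'M[F]_(n, m)) : r != 0 -> rscalemx r X = 0 -> X = 0.
Proof.
move=> r0 /matrixP rX0; apply/matrixP => i j; have := rX0 i j; rewrite !mxE.
by move/eqP; rewrite scaler_eq0 (negbTE r0) => /eqP.
Qed.

Lemma cd_mulmx0 n m p (A : 'M[F]_(n, m)) : cd_mulmx A (0 : 'M[F]_(m, p)) = 0.
Proof. by have := cd_mulmxB A 0 (0 : 'M[F]_(m, p)); rewrite !subrr. Qed.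

(** The partner of [v] is its image under [cd_adj A] divided by the square root of [l], and [l > 0]
    because [l * mxnormsq v] is the squared norm of that image. The nested product in the hypothesis
    keeps this valid over the octonions. *)
Lemma singular_value_of_gram n p (A : 'M[F]_(p, n)) l (v : 'cV[F]_p) :
  l != 0 -> v != 0 -> cd_mulmx A (cd_mulmx (cd_adj A) v) = rscalemx l v ->
  exists2 s, singular_values A s & s ^+ 2 = l.
Proof.
move=> l0 v0 AAv.
have lv : l * mxnormsq v = mxnormsq (cd_mulmx (cd_adj A) v).
  by rewrite -!vdotE -vdotZl -AAv vdot_adj.
have vpos : 0 < mxnormsq v by rewrite lt_neqAle mxnormsq_ge0 eq_sym mxnormsq_eq0 v0.
have lpos : 0 < l.
  rewrite lt_neqAle eq_sym l0/= -(pmulr_lge0 _ vpos) lv; exact: mxnormsq_ge0.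
have s0 : 0 < Num.sqrt l by rewrite sqrtr_gt0.
have s2 : Num.sqrt l ^+ 2 = l by rewrite sqr_sqrtr// ltW.
have sV : (Num.sqrt l)^-1 != 0 by rewrite invr_eq0 gt_eqF.
exists (Num.sqrt l) => //; split=> //.
exists v, (rscalemx (Num.sqrt l)^-1 (cd_mulmx (cd_adj A) v)); split=> //.
- apply/eqP => /(rscalemx_eq0 sV) Av0.
  move: AAv; rewrite Av0 cd_mulmx0 => /esym /(rscalemx_eq0 l0) /eqP.
  by rewrite (negbTE v0).
- rewrite cd_mulmxZ AAv rscalemx_comp (_ : _ * l = Num.sqrt l)//.
  by rewrite -[X in _ * X]s2 expr2 mulKf// gt_eqF.
- rewrite rscalemx_comp divff ?gt_eqF//.
  by apply/matrixP => i j; rewrite [RHS]mxE scale1r.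
Qed.

Lemma nonnull_eigenvalues_gram n p (A : 'M[F]_(p, n)) : (k <= 2)%N ->
  nonnull_eigenvalues (cd_mulmx A (cd_adj A)) =
  (fun s => s ^+ 2) @` singular_values A.
Proof.
move=> k2; apply/seteqP; split=> [l [l0 [v v0]]|_ [s [s0 [u [v [u0 v0 Av Au]]]] <-]].
  rewrite -cd_mulmxA// => AAv.
  by have [s As sl] := singular_value_of_gram l0 v0 AAv; exists s.
split; first by rewrite expf_neq0// gt_eqF.
exists u => //.
by rewrite -cd_mulmxA// Au cd_mulmxZ Av rscalemx_comp expr2.
Qed.

Lemma lambda_gram_assoc n p (A : 'M[F]_(p, n)) i : (k <= 2)%N -> frakL n p n A ->
  (i < n)%N -> lambda (cd_mulmx A (cd_adj A)) i = sigma A i ^+ 2.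
Proof.
move=> k2 [_ An] iN; rewrite /lambda nonnull_eigenvalues_gram//.
apply: (ith_largest_image An iN (f := fun s => s ^+ 2)) => s t [s0 _] [t0 _].
by rewrite ler_pXn2r// nnegrE ltW.
Qed.

(** Needed because [ith_largest] is meaningful on finite sets only. Eigenvalues over [F] are
    eigenvalues of the associated real matrix, hence roots of its characteristic polynomial. *)
Lemma finite_eigenvalues n (M : 'M[F]_n) : finite_set (nonnull_eigenvalues M).
Proof.
pose L (x : coords R (mx_index k n 1)) := mx_coord (cd_mulmx M (mx_of_coord x)).
have LD x y : L (fun i => x i + y i) = fun j => L x j + L y j.
  by rewrite /L mx_of_coordD cd_mulmxD mx_coordD.
have LZ r x : L (fun i => r * x i) = fun j => r * L x j.
  by rewrite /L mx_of_coordZ cd_mulmxZ mx_coordZ.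
apply: sub_finite_set (finite_roots (monic_neq0 (char_poly_monic (lin_coord_mx L)))).
move=> l [_ [v v0 Mv]] /=; rewrite -eigenvalue_root_char.
apply/eigenvalueP; exists (coord_row (mx_coord v)).
  rewrite -lin_coord_mxE// /L mx_coordK Mv mx_coordZ.
  by apply/rowP => j; rewrite !mxE.
apply: contra_neq v0 => /rowP cv0; apply: (can_inj (@mx_coordK R k n 1)).
by apply: coord_row_inj; apply/rowP => j; rewrite cv0 !mxE /mx_coord mxE cd_coord0.
Qed.

Lemma cd_cauchy_schwarz (x y : F) :
  cd_dot x y <= Num.sqrt (cd_normsq x) * Num.sqrt (cd_normsq y).
Proof.
set a := Num.sqrt _; set b := Num.sqrt _.
have a2 : a ^+ 2 = cd_normsq x by rewrite sqr_sqrtr// cd_normsq_ge0.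
have b2 : b ^+ 2 = cd_normsq y by rewrite sqr_sqrtr// cd_normsq_ge0.
have a0 : 0 <= a by exact: sqrtr_ge0.
have b0 : 0 <= b by exact: sqrtr_ge0.
have := cd_normsq_ge0 (b *: x - a *: y).
rewrite cd_normsqD cd_normsqN !cd_normsqZ cd_dotNr cd_dotZl cd_dotZr -a2 -b2.
have [a00|a00] := eqVneq a 0.
  have : x == 0 by rewrite -cd_normsq_eq0 -a2 a00 expr0n.
  by move=> /eqP ->; rewrite cd_dot0l mulr_ge0.
have [b00|b00] := eqVneq b 0.
  have : y == 0 by rewrite -cd_normsq_eq0 -b2 b00 expr0n.
  by move=> /eqP ->; rewrite cd_dotC cd_dot0l mulr_ge0.
have ab0 : 0 < a * b by rewrite mulr_gt0// lt_neqAle eq_sym ?a00 ?b00.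
move=> h; rewrite -subr_ge0 -(pmulr_rge0 _ ab0).
by move: h; nra.
Qed.

(** Over the octonions, multiplying by the matrix product of [A] and [cd_adj A] can differ from
    multiplying by the two factors in turn. Only the largest eigenvalue is identified: it is
    attained at [A] itself by [cd_mul_conjK] and bounded by Cauchy-Schwarz. Smaller eigenvalues are
    not excluded. *)
Lemma lambda_gram_col p (A : 'M[F]_(p, 1)) : (k <= 3)%N -> frakL 1 p 1 A ->
  lambda (cd_mulmx A (cd_adj A)) 0 = sigma A 0 ^+ 2.
Proof.
move=> k3 hA; rewrite (singular_value_col k3 (sigma_in hA (ltn0Sn 0))).
have Apos : 0 < mxnormsq A.
  rewrite -(singular_value_col k3 (sigma_in hA (ltn0Sn 0))).
  by rewrite exprn_gt0// sigma_gt0.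
have GE (v : 'cV[F]_p) i : cd_mulmx (cd_mulmx A (cd_adj A)) v i 0 =
    \sum_j cd_mul (cd_mul (A i 0) (cd_conj (A j 0))) (v j 0).
  by rewrite mxE; apply: eq_bigr => j _; rewrite !mxE big_ord1 !mxE.
have NE (v : 'cV[F]_p) : mxnormsq v = \sum_i cd_normsq (v i 0).
  by apply: eq_bigr => i _; rewrite big_ord1.
apply: ith_largest0; first exact: finite_eigenvalues.
  split; first by rewrite gt_eqF.
  exists A; first by rewrite -mxnormsq_eq0 gt_eqF.
  apply/matrixP => i j; rewrite ord1 GE mxE NE scaler_suml.
  by apply: eq_bigr => l _; rewrite cd_mul_conjK.
move=> l [l0 [v v0 Gv]].
have vpos : 0 < mxnormsq v by rewrite lt_neqAle mxnormsq_ge0 eq_sym mxnormsq_eq0 v0.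
rewrite -(ler_pM2r vpos) -vdotE -vdotZl -Gv vdotE /vdot.
under eq_bigr do rewrite GE cd_dot_suml.
pose s (x : F) := Num.sqrt (cd_normsq x).
have s2 x : s x ^+ 2 = cd_normsq x by rewrite sqr_sqrtr// cd_normsq_ge0.
have sM x y : s (cd_mul x y) = s x * s y.
  by rewrite /s cd_normsqM// sqrtrM// cd_normsq_ge0.
have sc x : s (cd_conj x) = s x by rewrite /s cd_normsq_conj.
(* Each term is at most [|A i| |A j| |v i| |v j|]; the inequality of arithmetic and geometric means
   groups the factors so that both halves sum to [mxnormsq A * mxnormsq v]. *)
apply: (@le_trans _ _ (\sum_i \sum_j
  ((cd_normsq (A i 0) * cd_normsq (v j 0) + cd_normsq (A j 0) * cd_normsq (v i 0)) / 2))).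
  apply: ler_sum => i _; apply: ler_sum => j _.
  apply: le_trans (cd_cauchy_schwarz _ _) _; rewrite -!/(s _) !sM sc -!s2.
  rewrite ler_pdivlMr//; have := sqr_ge0 (s (A i 0) * s (v j 0) - s (A j 0) * s (v i 0)).
  by nra.
have E1 : \sum_i \sum_j cd_normsq (A i 0) * cd_normsq (v j 0) = mxnormsq A * mxnormsq v.
  by rewrite !NE mulr_suml; apply: eq_bigr => i _; rewrite mulr_sumr.
have E2 : \sum_i \sum_j cd_normsq (A j 0) * cd_normsq (v i 0) = mxnormsq A * mxnormsq v.
  by rewrite exchange_big.
rewrite le_eqVlt; apply/orP; left; apply/eqP.
transitivity ((\sum_i \sum_j cd_normsq (A i 0) * cd_normsq (v j 0) +
  \sum_i \sum_j cd_normsq (A j 0) * cd_normsq (v i 0)) / 2); last by rewrite E1 E2; lra.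
rewrite -big_split mulr_suml; apply: eq_bigr => i _ /=.
by rewrite -big_split mulr_suml.
Qed.

Lemma powR_sqr_half (s : R) (N : nat) : 0 < s -> (s ^+ 2) `^ (N%:R / 2) = s ^+ N.
Proof.
move=> s0; rewrite -powR_mulrn ?ltW// -powRrM.
rewrite (_ : 2%:R * (N%:R / 2) = N%:R) ?powR_mulrn ?ltW//.
by rewrite mulrCA divff ?mulr1.
Qed.

End lambda_sigma.

(** * Octonion matrices with few singular values *)

Section symmetric_powers.
Context (R : realType).

(** A symmetric matrix is diagonalizable over [R[i]] with real eigenvalues, so each eigenvalue has
    to occur only once in the product. Cayley-Hamilton would count multiplicities and give a degree
    that grows with the real dimension. *)
Lemma symmetric_annihilated (N : nat) (G : 'M[R]_N.+1) (s : seq R) : G^T = G ->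
  (forall a, eigenvalue G a -> a \in s) ->
  horner_mx G (\prod_(a <- s) ('X - a%:P)) = 0.
Proof.
move=> Gsym sG; set p := \prod_(a <- s) _.
pose f := real_complex R : {rmorphism R -> R[i]}.
apply: (@map_mx_inj _ _ f); rewrite map_horner_mx map_mx0.
have fhermi : map_mx f G \is hermsymmx.
  apply: realsym_hermsym.
    by apply/is_hermitianmxP; rewrite expr0 scale1r map_mx_id// map_trmx Gsym.
  by apply/mxOverP => i j; rewrite mxE; apply/complex_realP; exists (G i j).
have /hermitian_normalmx /orthomx_spectralP GE := fhermi.
set P := spectralmx _ in GE; set D := spectral_diag _ in GE.
have Punit : P \in unitmx by exact: spectral_unit.
have PG : P *m map_mx f G = diag_mx D *m P by rewrite {1}GE -mulmxA mulKVmx.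
have DF0 : map_mx (horner (map_poly f p)) D = 0.
  apply/rowP => j; rewrite !mxE.
  have /mxOverP/(_ 0 j)/complex_realP[a Da] := hermitian_spectral_diag_real fhermi.
  rewrite -/D in Da.
  rewrite Da horner_map (rootP _) ?rmorph0//.
  rewrite root_prod_XsubC; apply: sG; rewrite -(eigenvalue_map f).
  apply/eigenvalueP; exists (row j P).
    by rewrite -row_mul PG row_mul row_diag_mx -scalemxAl -rowE Da.
  rewrite rowE; apply/eqP => /(congr1 (mulmx^~ (invmx P))).
  rewrite mulmxK// mul0mx => /rowP/(_ j); rewrite !mxE !eqxx => /eqP.
  by rewrite oner_eq0.
by rewrite GE horner_mx_uconjC// horner_mx_diag DF0 raddf0 mulmx0 mul0mx.
Qed.

Lemma symmetric_powers_dep (N : nat) (G : 'M[R]_N) (s : seq R) : G^T = G ->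
  (forall a, eigenvalue G a -> a \in s) ->
  exists2 u : 'rV[R]_(size s).+1, u != 0 & \sum_i u 0 i *: G ^+ i = 0.
Proof.
case: N G => [|N] G Gsym sG.
  (* [horner_mx] asks for a positive size; for [N = 0] every combination of powers is the empty
     matrix. *)
  exists (const_mx 1); last by apply/matrixP => -[].
  by apply/eqP => /rowP/(_ 0); rewrite !mxE => /eqP; rewrite oner_eq0.
pose p := \prod_(a <- s) ('X - a%:P).
have szp : size p = (size s).+1 by rewrite size_prod_XsubC.
exists (poly_rV p).
  apply: contraTneq (monic_prod_XsubC s xpredT id) => /(congr1 rVpoly).
  by rewrite poly_rV_K ?szp// raddf0 /p => ->; rewrite monicE lead_coef0 eq_sym oner_eq0.
rewrite -[RHS](symmetric_annihilated Gsym sG) -/p.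
rewrite -[in RHS](@poly_rV_K _ (size s).+1 p) ?szp//.
rewrite [in RHS]horner_rVpoly.
apply: (can_inj mxvecK); rewrite vec_mxK linear_sum/= mulmx_sum_row.
apply: eq_bigr => i _; by rewrite linearZ/= rowK.
Qed.

(** A dependency among the first [d] powers is a polynomial of degree below [d] that vanishes at [d]
    distinct eigenvalues. *)
Lemma powers_indep (N d : nat) (G : 'M[R]_N) (l : 'I_d -> R) (w : 'I_d -> 'rV[R]_N)
    (u : 'rV[R]_d) : injective l -> (forall j, w j != 0) ->
  (forall j, w j *m G = l j *: w j) -> \sum_i u 0 i *: G ^+ i = 0 -> u = 0.
Proof.
move=> linj w0 wG uG.
have wGi j i : w j *m G ^+ i = l j ^+ i *: w j.
  elim: i => [|i IH]; first by rewrite expr0 scale1r mulmx1.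
  by rewrite exprS -mulmxE mulmxA wG -scalemxAl IH scalerA exprS.
have rootl j : root (rVpoly u) (l j).
  have : (\sum_i u 0 i * l j ^+ i) *: w j = 0.
    rewrite -[RHS](mulmx0 _ (w j)) -uG mulmx_sumr scaler_suml.
    by apply: eq_bigr => i _; rewrite -scalemxAr wGi scalerA.
  move=> /eqP; rewrite scaler_eq0 (negbTE (w0 j)) orbF => /eqP S0.
  rewrite rootE; apply/eqP; rewrite (horner_coef_wide _ (size_poly _ _)) -[RHS]S0.
  by apply: eq_bigr => i _; rewrite coef_rVpoly_ord.
have [r0|p0] := eqVneq (rVpoly u) 0.
  by rewrite -(rVpolyK u) r0 raddf0.
have : (size [seq l j | j : 'I_d] < size (rVpoly u))%N.
  apply: max_poly_roots => //; first by apply/allP => _ /mapP[j _ ->].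
  by rewrite map_inj_uniq// enum_uniq.
by rewrite size_map size_enum_ord ltnNge size_poly.
Qed.

End symmetric_powers.

(** * Polynomial dependence on a real parameter *)

Section polynomial_functions.
Context (R : realType).

(** [hmeas_finite_rays] looks only at lines through the witness, so polynomials in one variable
    suffice. *)
Definition polyfun (g : R -> R) := exists p : {poly R}, forall t, g t = p.[t].

Lemma polyfun_cst c : polyfun (fun=> c).
Proof. by exists c%:P => t; rewrite hornerC. Qed.

Lemma polyfun_id : polyfun id.
Proof. by exists 'X => t; rewrite hornerX. Qed.

Lemma polyfunD g h : polyfun g -> polyfun h -> polyfun (fun t => g t + h t).
Proof. by move=> [p gp] [q hq]; exists (p + q) => t; rewrite hornerD gp hq. Qed.

Lemma polyfunM g h : polyfun g -> polyfun h -> polyfun (fun t => g t * h t).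
Proof. by move=> [p gp] [q hq]; exists (p * q) => t; rewrite hornerM gp hq. Qed.

Lemma polyfunN g : polyfun g -> polyfun (fun t => - g t).
Proof. by move=> [p gp]; exists (- p) => t; rewrite hornerN gp. Qed.

Lemma polyfun_sum (J : finType) (g : J -> R -> R) :
  (forall j, polyfun (g j)) -> polyfun (fun t => \sum_j g j t).
Proof.
move=> /choice[p gp]; exists (\sum_j p j) => t.
by rewrite horner_sum; apply: eq_bigr.
Qed.

Lemma polyfun_prod (J : finType) (g : J -> R -> R) :
  (forall j, polyfun (g j)) -> polyfun (fun t => \prod_j g j t).
Proof.
move=> /choice[p gp]; exists (\prod_j p j) => t.
by rewrite horner_prod; apply: eq_bigr.
Qed.

Lemma polyfun_det N (M : R -> 'M[R]_N) :
  (forall i j, polyfun (fun t => M t i j)) -> polyfun (fun t => \det (M t)).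
Proof.
move=> Mp; apply: polyfun_sum => s; apply: polyfunM; first exact: polyfun_cst.
by apply: polyfun_prod => i; exact: Mp.
Qed.

Lemma polyfun_mulmx n m p (M : R -> 'M[R]_(n, m)) (M' : R -> 'M[R]_(m, p)) :
  (forall i j, polyfun (fun t => M t i j)) ->
  (forall i j, polyfun (fun t => M' t i j)) ->
  forall i j, polyfun (fun t => (M t *m M' t) i j).
Proof.
move=> Mp Mp' i j.
have [p' pE] : polyfun (fun t => \sum_l M t i l * M' t l j).
  by apply: polyfun_sum => l; apply: polyfunM.
by exists p' => t; rewrite mxE pE.
Qed.

Lemma polyfun_finite_zeros g : polyfun g -> g 0 != 0 -> finite_set [set t | g t = 0].
Proof.
move=> [p gp]; rewrite gp => p0.
apply: sub_finite_set (finite_roots (_ : p != 0)).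
  by move=> t /=; rewrite gp rootE => /eqP.
by apply: contra_neq p0 => ->; rewrite horner0.
Qed.

Definition cd_polyfun k (z : R -> cd R k) :=
  forall l, polyfun (fun t => cd_coord (z t) l).

Lemma cd_polyfunD k (z w : R -> cd R k) : cd_polyfun z -> cd_polyfun w ->
  cd_polyfun (fun t => z t + w t).
Proof.
move=> zp wp l; under eq_fun do rewrite cd_coordD.
exact: polyfunD.
Qed.

Lemma cd_polyfunN k (z : R -> cd R k) : cd_polyfun z -> cd_polyfun (fun t => - z t).
Proof.
move=> zp l; rewrite (_ : (fun t => _) = fun t => - cd_coord (z t) l).
  exact: polyfunN.
by apply/funext => t; rewrite -scaleN1r cd_coordZ mulN1r.
Qed.

Lemma cd_polyfun_conj k (z : R -> cd R k) : cd_polyfun z ->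
  cd_polyfun (fun t => cd_conj (z t)).
Proof.
elim: k z => [//|k IH] z zp [] l /=.
  by apply: (IH (fun t => (z t).1)) => i; exact: (zp (inl i)).
by apply: (@cd_polyfunN _ (fun t => (z t).2)) => i; exact: (zp (inr i)).
Qed.

Lemma cd_polyfunM k (z w : R -> cd R k) : cd_polyfun z -> cd_polyfun w ->
  cd_polyfun (fun t => cd_mul (z t) (w t)).
Proof.
elim: k z w => [|k IH] z w zp wp.
  by move=> l; apply: polyfunM; [exact: (zp tt)|exact: (wp tt)].
have z1 : cd_polyfun (fun t => (z t).1) by move=> i; exact: (zp (inl i)).
have z2 : cd_polyfun (fun t => (z t).2) by move=> i; exact: (zp (inr i)).
have w1 : cd_polyfun (fun t => (w t).1) by move=> i; exact: (wp (inl i)).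
have w2 : cd_polyfun (fun t => (w t).2) by move=> i; exact: (wp (inr i)).
case=> l /=.
  apply: cd_polyfunD; first exact: IH.
  by apply: cd_polyfunN; apply: IH => //; exact: cd_polyfun_conj.
by apply: cd_polyfunD; apply: IH => //; exact: cd_polyfun_conj.
Qed.

Lemma cd_polyfun_sum k (J : finType) (z : J -> R -> cd R k) :
  (forall j, cd_polyfun (z j)) -> cd_polyfun (fun t => \sum_j z j t).
Proof.
move=> zp l; rewrite (_ : (fun t => _) = fun t => \sum_j cd_coord (z j t) l).
  by apply: polyfun_sum => j; exact: zp.
apply/funext => t; elim/big_rec2: _ => [|j y1 y2 _ <-]; first exact: cd_coord0.
by rewrite cd_coordD.
Qed.

Lemma cd_polyfun_mulmx k n m p (A : R -> 'M[cd R k]_(n, m)) (B : R -> 'M[cd R k]_(m, p)) :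
  (forall i j, cd_polyfun (fun t => A t i j)) ->
  (forall i j, cd_polyfun (fun t => B t i j)) ->
  forall i j, cd_polyfun (fun t => cd_mulmx (A t) (B t) i j).
Proof.
move=> Ap Bp i j; under eq_fun do rewrite mxE.
by apply: cd_polyfun_sum => l; apply: cd_polyfunM.
Qed.

End polynomial_functions.

(** * The real Gram operator of a matrix *)

Section gram_matrix.
Context (R : realType) (k n m : nat).
Local Notation F := (cd R k).
Local Notation N := #|mx_index k n 1|.

Definition gram_fun (X : 'M[F]_(n, m)) (x : coords R (mx_index k n 1)) :=
  mx_coord (cd_mulmx X (cd_mulmx (cd_adj X) (mx_of_coord x))).

(* The real matrix of u |-> X (X^* u); for octonions this is not the product
   by X X^*. *)
Definition gram_mx (X : 'M[F]_(n, m)) : 'M[R]_N := lin_coord_mx (gram_fun X).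

Lemma gram_mxE (X : 'M[F]_(n, m)) (u : 'cV[F]_n) :
  coord_row (mx_coord u) *m gram_mx X =
  coord_row (mx_coord (cd_mulmx X (cd_mulmx (cd_adj X) u))).
Proof.
rewrite -lin_coord_mxE ?/gram_fun ?mx_coordK// => [x y|r x].
  by rewrite mx_of_coordD !cd_mulmxD mx_coordD.
by rewrite mx_of_coordZ !cd_mulmxZ mx_coordZ.
Qed.

Lemma coord_row_vec (r : 'rV[R]_N) : exists u : 'cV[F]_n, coord_row (mx_coord u) = r.
Proof.
have [x <-] := coord_row_surj r.
by exists (mx_of_coord x); rewrite mx_of_coordK.
Qed.

Lemma vdot_coord (u v : 'cV[F]_n) :
  coord_row (mx_coord u) *m (coord_row (mx_coord v))^T = (vdot u v)%:M.
Proof.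
apply/matrixP => a b; rewrite !ord1 !mxE mulr1n.
transitivity (\sum_(i : mx_index k n 1) mx_coord u i * mx_coord v i).
  rewrite [RHS](reindex_onto enum_val enum_rank)/= => [|i _]; last by rewrite enum_rankK.
  by apply: eq_big => i; rewrite ?enum_valK ?eqxx// !mxE.
rewrite -(pair_bigA _ (fun ij l =>
  cd_coord (u ij.1 ij.2) l * cd_coord (v ij.1 ij.2) l))/=.
rewrite -(pair_bigA _ (fun i j => \sum_l cd_coord (u i j) l * cd_coord (v i j) l))/=.
by apply: eq_bigr => i _; rewrite big_ord1 cd_dot_coord.
Qed.

(** Symmetry comes from two uses of [vdot_adj], which holds for the octonions too. *)
Lemma gram_mx_sym (X : 'M[F]_(n, m)) : (gram_mx X)^T = gram_mx X.
Proof.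
suff H (r s : 'rV[R]_N) : r *m gram_mx X *m s^T = r *m (s *m gram_mx X)^T.
  apply/matrixP => i j; have := H (delta_mx 0 j) (delta_mx 0 i).
  rewrite trmx_mul trmx_delta !mulmxA -!rowE -!colE => /matrixP/(_ 0 0).
  by rewrite !mxE.
have [u <-] := coord_row_vec r; have [v <-] := coord_row_vec s.
rewrite !gram_mxE !vdot_coord; congr (_%:M).
by rewrite vdot_adj [RHS]vdotC [RHS]vdot_adj vdotC.
Qed.

Lemma gram_mx_eigenvalue (X : 'M[F]_(n, m)) a : eigenvalue (gram_mx X) a ->
  a = 0 \/ exists2 s, singular_values X s & s ^+ 2 = a.
Proof.
move=> /eigenvalueP[r]; have [u <-] := coord_row_vec r.
rewrite gram_mxE => Xu u0; have [->|a0] := eqVneq a 0; [by left|right].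
apply: (@singular_value_of_gram _ _ _ _ X a u) => //.
  by apply: contra_neq u0 => ->; apply/rowP => i; rewrite !mxE /mx_coord mxE cd_coord0.
apply: (can_inj (@mx_coordK R k n 1)); apply: coord_row_inj.
by rewrite Xu mx_coordZ; apply/rowP => i; rewrite !mxE.
Qed.

Lemma polyfun_gram_mx (X : R -> 'M[F]_(n, m)) :
  (forall i j, cd_polyfun (fun t => X t i j)) ->
  forall i j, polyfun (fun t => gram_mx (X t) i j).
Proof.
move=> Xp i j; rewrite (_ : (fun t => _) = fun t =>
  gram_fun (X t) (fun l => (enum_val i == l)%:R) (enum_val j)); last first.
  by apply/funext => t; rewrite mxE.
rewrite /gram_fun /mx_coord; apply: cd_polyfun_mulmx => // a b.
apply: cd_polyfun_mulmx => [c d|c d l]; last exact: polyfun_cst.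
by under eq_fun do rewrite mxE; exact: cd_polyfun_conj.
Qed.

(** Powers are flattened into rows, so that a linear dependency among them is a left kernel
    vector. *)
Definition gram_powers (d : nat) (X : 'M[F]_(n, m)) : 'M[R]_(d, N * N) :=
  \matrix_(i < d) mxvec (gram_mx X ^+ i).

Lemma polyfun_gram_powers d (X : R -> 'M[F]_(n, m)) :
  (forall i j, cd_polyfun (fun t => X t i j)) ->
  forall i j, polyfun (fun t => gram_powers d (X t) i j).
Proof.
move=> Xp i j; have /polyfun_gram_mx Gp := Xp.
have pw e : forall a b, polyfun (fun t => (gram_mx (X t) ^+ e) a b).
  elim: e => [|e IH] a b; first exact: polyfun_cst.
  by under eq_fun do rewrite exprS -mulmxE; exact: polyfun_mulmx.
case/mxvec_indexP: j => a b.
by under eq_fun do rewrite mxE mxvecE; exact: pw.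
Qed.

End gram_matrix.

(** * An octonion matrix with many Gram eigenvalues *)

Section octonion_witness.
Context (R : realType).
Local Notation O := (cd R 3).

Definition oct (a b c d e f g h : R) : O := (((a, b), (c, d)), ((e, f), (g, h))).

Lemma oct_eq (x y : O) :
  [/\ x.1.1.1 = y.1.1.1, x.1.1.2 = y.1.1.2, x.1.2.1 = y.1.2.1 & x.1.2.2 = y.1.2.2] ->
  [/\ x.2.1.1 = y.2.1.1, x.2.1.2 = y.2.1.2, x.2.2.1 = y.2.2.1 & x.2.2.2 = y.2.2.2] ->
  x = y.
Proof.
case: x y => [[[? ?] [? ?]] [[? ?] [? ?]]] [[[? ?] [? ?]] [[? ?] [? ?]]] /=.
by move=> [-> -> -> ->] [-> -> -> ->].
Qed.

Lemma oct_mul a0 a1 a2 a3 a4 a5 a6 a7 b0 b1 b2 b3 b4 b5 b6 b7 :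
  cd_mul (oct a0 a1 a2 a3 a4 a5 a6 a7) (oct b0 b1 b2 b3 b4 b5 b6 b7) = oct
    (a0 * b0 - a1 * b1 - a2 * b2 - a3 * b3 - a4 * b4 - a5 * b5 - a6 * b6 - a7 * b7)
    (a0 * b1 + a1 * b0 + a2 * b3 - a3 * b2 + a4 * b5 - a5 * b4 - a6 * b7 + a7 * b6)
    (a0 * b2 - a1 * b3 + a2 * b0 + a3 * b1 + a4 * b6 + a5 * b7 - a6 * b4 - a7 * b5)
    (a0 * b3 + a1 * b2 - a2 * b1 + a3 * b0 + a4 * b7 - a5 * b6 + a6 * b5 - a7 * b4)
    (a0 * b4 - a1 * b5 - a2 * b6 - a3 * b7 + a4 * b0 + a5 * b1 + a6 * b2 + a7 * b3)
    (a0 * b5 + a1 * b4 - a2 * b7 + a3 * b6 - a4 * b1 + a5 * b0 - a6 * b3 + a7 * b2)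
    (a0 * b6 + a1 * b7 + a2 * b4 - a3 * b5 - a4 * b2 + a5 * b3 + a6 * b0 - a7 * b1)
    (a0 * b7 - a1 * b6 + a2 * b5 + a3 * b4 - a4 * b3 - a5 * b2 + a6 * b1 + a7 * b0).
Proof. by apply: oct_eq => /=; split; ring. Qed.

Lemma oct_conj a b c d e f g h :
  cd_conj (oct a b c d e f g h) = oct a (- b) (- c) (- d) (- e) (- f) (- g) (- h).
Proof. by []. Qed.

Lemma oct_add a0 a1 a2 a3 a4 a5 a6 a7 b0 b1 b2 b3 b4 b5 b6 b7 :
  oct a0 a1 a2 a3 a4 a5 a6 a7 + oct b0 b1 b2 b3 b4 b5 b6 b7 =
  oct (a0 + b0) (a1 + b1) (a2 + b2) (a3 + b3) (a4 + b4) (a5 + b5) (a6 + b6) (a7 + b7).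
Proof. by []. Qed.

Lemma oct_scale r a b c d e f g h : r *: oct a b c d e f g h =
  oct (r * a) (r * b) (r * c) (r * d) (r * e) (r * f) (r * g) (r * h).
Proof. by []. Qed.

Lemma oct0 : 0 = oct 0 0 0 0 0 0 0 0.
Proof. by []. Qed.

Local Arguments cd_mul : simpl never.
Local Arguments cd_conj : simpl never.

Let e0 (r : R) := oct r 0 0 0 0 0 0 0.
Let e1 (r : R) := oct 0 r 0 0 0 0 0 0.
Let e2 (r : R) := oct 0 0 r 0 0 0 0 0.
Let e3 (r : R) := oct 0 0 0 r 0 0 0 0.
Let e4 (r : R) := oct 0 0 0 0 r 0 0 0.

(* The block [e3, e1; 2, -2 e2] acts on the quaternions spanned by 1, e1, e2, e3
   and on their complement with different singular values: 0, 10 and 2, 8. *)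
Definition witness (i j : nat) : O :=
  match i, j with
  | 0, 0 => e3 1 | 0, 1 => e1 1
  | 1, 0 => e0 2 | 1, 1 => e2 (- 2)
  | i'.+2, j'.+2 => if i' == j' then e0 (i' + 5)%:R else 0
  | _, _ => 0
  end.

(** The shift by [5] puts the eigenvalues of the diagonal part at [25] or more, clear of the values
    [0], [2], [8], [10] of the block. *)
Definition witness_eigenvalue (j : nat) : nat :=
  match j with 0 => 0 | 1 => 2 | 2 => 8 | 3 => 10 | j'.+4 => ((j' + 5) ^ 2)%N end.

Definition witness_eigenvector (j i : nat) : O :=
  match j, i with
  | 0, 0 => e3 (- 2) | 0, 1 => e0 1
  | 1, 0 => e4 1 | 2, 1 => e4 1
  | 3, 0 => e3 1 | 3, 1 => e0 2
  | j'.+4, i'.+2 => if i' == j' then e0 1 else 0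
  | _, _ => 0
  end.

(** The intermediate vectors: the adjoint of the witness applied to each eigenvector. They are
    tabulated so that the two multiplications can be verified one after the other. *)
Definition witness_adj_image (j i : nat) : O :=
  match j, i with
  | 1, 0 => oct 0 0 0 0 0 0 0 (-1)
  | 1, 1 => oct 0 0 0 0 0 (-1) 0 0
  | 2, 0 => e4 2 | 2, 1 => oct 0 0 0 0 0 0 2 0
  | 3, 0 => e0 5 | 3, 1 => e2 5
  | j'.+4, i'.+2 => if i' == j' then e0 (j' + 5)%:R else 0
  | _, _ => 0
  end.

Lemma witness_eigenvalue_inj : injective witness_eigenvalue.
Proof.
have lt_big l c : ((l + 5) ^ 2)%N = c -> (c < 25)%N -> False.
  move=> lc; rewrite -lc ltnNge.
  by rewrite (@leq_sqr 5 (l + 5)) leq_addl.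
move=> [|[|[|[|i]]]] [|[|[|[|j]]]] //=;
  try by [move=> h; case: (lt_big _ _ h isT)];
  try by [move=> /esym h; case: (lt_big _ _ h isT)].
by move=> /eqP; rewrite eqn_sqr eqn_add2r => /eqP ->.
Qed.

Variables (n m : nat).
Hypothesis nm : (n <= m)%N.

Definition witness_mx : 'M[O]_(n.+2, m.+2) := \matrix_(i, j) witness i j.

Lemma big_ord_two (V : nmodType) (q : nat) (f : nat -> V) :
  \sum_(i < q.+2) f i = f 0%N + f 1%N + \sum_(i < q) f i.+2.
Proof. by rewrite !big_ord_recl /= addrA. Qed.

Lemma witness_eigenvector_neq0 (j : 'I_n.+4) :
  \col_(i < n.+2) witness_eigenvector j i != 0.
Proof.
have neq0 (i : 'I_n.+2) : cd_normsq (witness_eigenvector j i) != 0 ->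
    \col_(i < n.+2) witness_eigenvector j i != 0.
  apply: contra_neq => /matrixP/(_ i 0); rewrite !mxE => ->.
  by apply/eqP; rewrite cd_normsq_eq0.
case: j neq0 => [[|[|[|[|j]]]] jn] neq0.
- by apply: (neq0 (lift ord0 ord0)); apply/eqP => /= h; lra.
- by apply: (neq0 ord0); apply/eqP => /= h; lra.
- by apply: (neq0 (lift ord0 ord0)); apply/eqP => /= h; lra.
- by apply: (neq0 ord0); apply/eqP => /= h; lra.
- have jn' : (j.+2 < n.+2)%N by [].
  by apply: (neq0 (Ordinal jn')); apply/eqP; rewrite /= eqxx /= => h; lra.
Qed.

Lemma witness_adj (j : 'I_n.+4) (c : 'I_m.+2) :
  \sum_(i < n.+2) cd_mul (cd_conj (witness i c)) (witness_eigenvector j i) =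
  witness_adj_image j c.
Proof.
rewrite (big_ord_two _ (fun i =>
  cd_mul (cd_conj (witness i c)) (witness_eigenvector j i))).
case: j c => [j jn] [c cm] /=; have [j4|j4] := ltnP j 4.
  rewrite big1 ?addr0; last first.
    by move=> i _; case: j j4 {jn} => [|[|[|[|]]]]//; rewrite cd_mul0r.
  case: c cm => [|[|c]] _; last first.
  - by case: j jn j4 => [|[|[|[|//]]]] _ _ /=; rewrite !cd_conj0 !cd_mul0l addr0.
  - by case: j jn j4 => [|[|[|[|//]]]] _ _ /=; rewrite /e0 /e1 /e2 /e3 /e4 ?oct0
      !oct_conj !oct_mul oct_add; congr oct; ring.
  - by case: j jn j4 => [|[|[|[|//]]]] _ _ /=; rewrite /e0 /e1 /e2 /e3 /e4 ?oct0
      !oct_conj !oct_mul oct_add; congr oct; ring.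
case: j jn j4 => [|[|[|[|j]]]] // jn _ /=; rewrite !cd_mul0r !add0r.
have jn' : (j < n)%N by [].
case: c cm => [|[|c]] _ /=.
- by rewrite big1// => i _; rewrite cd_conj0 cd_mul0l.
- by rewrite big1// => i _; rewrite cd_conj0 cd_mul0l.
rewrite (bigD1 (Ordinal jn'))//= big1 ?addr0 ?eqxx; last first.
  by move=> i /negbTE; rewrite -val_eqE /= => ->; rewrite cd_mul0r.
rewrite [c == j]eq_sym; case: eqP => _; last by rewrite cd_conj0 cd_mul0l.
by rewrite /e0 oct_conj oct_mul; congr oct; ring.
Qed.

Lemma witness_image (j : 'I_n.+4) (i : 'I_n.+2) :
  \sum_(c < m.+2) cd_mul (witness i c) (witness_adj_image j c) =
  (witness_eigenvalue j)%:R *: witness_eigenvector j i.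
Proof.
rewrite (big_ord_two _ (fun c => cd_mul (witness i c) (witness_adj_image j c))).
case: j i => [j jn] [i iN] /=; have [j4|j4] := ltnP j 4.
  rewrite big1 ?addr0; last first.
    by move=> l _; case: j j4 {jn} => [|[|[|[|]]]]//; rewrite cd_mul0r.
  case: i iN => [|[|i]] _; last first.
  - by case: j jn j4 => [|[|[|[|//]]]] _ _ /=; rewrite !cd_mul0l addr0 scaler0.
  - by case: j jn j4 => [|[|[|[|//]]]] _ _ /=; rewrite /e0 /e1 /e2 /e3 /e4 ?oct0
      !oct_mul oct_add oct_scale; congr oct; ring.
  - by case: j jn j4 => [|[|[|[|//]]]] _ _ /=; rewrite /e0 /e1 /e2 /e3 /e4 ?oct0
      !oct_mul oct_add oct_scale; congr oct; ring.
case: j jn j4 => [|[|[|[|j]]]] // jn _ /=; rewrite !cd_mul0r !add0r.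
have jm : (j < m)%N by apply: leq_trans nm.
case: i iN => [|[|i]] iN /=.
- by rewrite big1 ?scaler0// => l _; rewrite cd_mul0l.
- by rewrite big1 ?scaler0// => l _; rewrite cd_mul0l.
rewrite (bigD1 (Ordinal jm))//= big1 ?addr0 ?eqxx; last first.
  by move=> l /negbTE; rewrite -val_eqE /= => ->; rewrite cd_mul0r.
case: eqP => [->|_]; last by rewrite cd_mul0l scaler0.
rewrite natrX.
by rewrite /e0 oct_mul oct_scale; congr oct; ring.
Qed.

End octonion_witness.

Section octonion_null_sets.
Context (R : realType).
Local Notation O := (cd R 3).

Lemma gram_powers_dep k n m (X : 'M[cd R k]_(n, m)) : frakL m n n X ->
  exists2 u : 'rV[R]_n.+2, u != 0 & u *m gram_powers n.+2 X = 0.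
Proof.
move=> [_ Xn]; have finS : finite_set (singular_values X) by exists n.
(* An eigenvalue [0] of the Gram operator has no singular value attached, so it is listed
   separately. *)
pose s := 0 :: [seq x ^+ 2 | x <- enum_fset (fset_set (singular_values X))].
have sG a : eigenvalue (gram_mx X) a -> a \in s.
  move=> /gram_mx_eigenvalue[->|[x Xx <-]]; rewrite inE ?eqxx//.
  by apply/orP; right; apply: map_f; rewrite in_fset_set// inE.
have := symmetric_powers_dep (gram_mx_sym X) sG.
have -> : size s = n.+1 by rewrite /= size_map (size_fset_set_card Xn).
move=> [u u0 uG]; exists u => //; apply: (can_inj vec_mxK).
rewrite mulmx_sum_row !linear_sum linear0 -[RHS]uG; apply: eq_bigr => i _.
by rewrite rowK !linearZ/= mxvecK.
Qed.

Lemma gram_powers_witness n m : (n <= m)%N ->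
  row_free (gram_powers n.+4 (witness_mx R n m)).
Proof.
move=> nm; rewrite -kermx_eq0; apply/rowV0P => u /sub_kermxP uG.
pose w (j : 'I_n.+4) : 'cV[O]_n.+2 := \col_i witness_eigenvector R j i.
have wG j : cd_mulmx (witness_mx R n m) (cd_mulmx (cd_adj (witness_mx R n m)) (w j)) =
    rscalemx (witness_eigenvalue j)%:R (w j).
  apply/matrixP => i l; rewrite !mxE -(@witness_image R n m nm j i).
  apply: eq_bigr => c _; rewrite !mxE -(witness_adj R j c); congr cd_mul.
  by apply: eq_bigr => h _; rewrite !mxE.
apply: (@powers_indep _ _ _ (gram_mx (witness_mx R n m))
  (fun j => (witness_eigenvalue j)%:R) (fun j => coord_row (mx_coord (w j)))).
- by move=> i j /eqP; rewrite eqr_nat => /eqP /witness_eigenvalue_inj /val_inj.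
- move=> j; rewrite -[0](_ : coord_row (mx_coord (0 : 'cV[O]_n.+2)) = 0); last first.
    by apply/rowP => i; rewrite !mxE /mx_coord mxE cd_coord0.
  apply/eqP => /coord_row_inj/(can_inj (@mx_coordK _ _ _ _)) w0.
  by have := @witness_eigenvector_neq0 R n j; rewrite -/(w j) w0 eqxx.
- move=> j; rewrite gram_mxE wG mx_coordZ.
  by apply/rowP => i; rewrite !mxE.
- have := congr1 vec_mx uG; rewrite mulmx_sum_row !linear_sum linear0 => uG'.
  rewrite -[RHS]uG'; apply: eq_bigr => i _.
  by rewrite rowK !linearZ/= mxvecK.
Qed.

Lemma cd_rank_le_cols k n m (X : 'M[cd R k]_(n, m)) : (cd_rank X <= m)%N.
Proof.
apply/bigmax_leqP => J _; apply: leq_trans (max_card _) _.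
by rewrite card_ord.
Qed.

(* A set of n x m octonion matrices with n <> 0, 1 and only n distinct singular
   values is null: such matrices are zeros of a polynomial that does not vanish at
   the witness. *)
Lemma octonion_null n m (E : set 'M[O]_(n, m)) : (1 < n)%N -> borel E ->
  (forall X, E X -> frakL m n n X) -> vol (n * m * 2 ^ 3) E = 0%E.
Proof.
move=> n1 bE EX; have [mn|nm] := ltnP m n.
  rewrite (_ : E = set0) ?vol_coord ?image_set0 ?outer_measure0//.
  apply/seteqP; split=> // X /EX[Xn _].
  by have := cd_rank_le_cols X; rewrite Xn leqNgt mn.
case: n n1 nm E bE EX => [|[|n]]// _; case: m => [|[|m]]// nm E bE EX.
rewrite vol_coord image_mx_coord.
pose X0 := witness_mx R n m.
(* The right inverse [C] at the witness yields a single determinant that equals [1] there, which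
   avoids selecting a nonzero minor. *)
have /row_freeP[C KC] : row_free (gram_powers n.+4 X0) by exact: gram_powers_witness.
pose f (X : 'M[O]_(n.+2, m.+2)) := \det (gram_powers n.+4 X *m C).
have f0 X : E X -> f X = 0.
  move=> /EX /gram_powers_dep[u u0 uK]; apply/eqP/det0P; exists u => //.
  by rewrite mulmxA uK mul0mx.
apply: (@hmeas_finite_rays _ _ _ (mx_coord X0)); first exact: measurable_borel.
move=> x.
pose Xt t := mx_of_coord (fun i => mx_coord X0 i + t * (x i - mx_coord X0 i)).
have ft : polyfun (fun t => f (Xt t)).
  apply: polyfun_det; apply: polyfun_mulmx => [i j|i j]; last exact: polyfun_cst.
  apply: polyfun_gram_powers => {}i {}j l; rewrite /Xt.
  under eq_fun do rewrite mxE cd_of_coordK.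
  apply: polyfunD; first exact: polyfun_cst.
  by apply: polyfunM; [exact: polyfun_id|exact: polyfun_cst].
apply: sub_finite_set (polyfun_finite_zeros ft _); first by move=> t /f0.
have -> : Xt 0 = X0.
  rewrite -[RHS]mx_coordK; congr mx_of_coord; apply/funext => i.
  by rewrite mul0r addr0.
by rewrite /f KC det1 oner_eq0.
Qed.

End octonion_null_sets.

(** * Images of null sets under multiplication *)

Section null_images.
Context (R : realType) (k : nat).
Local Notation F := (cd R k).

(** The constant comes from bounding the squared norm of a sum of two terms by twice the sum of
    their squared norms, once per term. Null images only call for some finite constant. *)
Lemma cd_normsq_sum_le (s : seq F) :
  cd_normsq (\sum_(x <- s) x) <= 2 ^+ size s * \sum_(x <- s) cd_normsq x.
Proof.
elim: s => [|x s IH].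
  by rewrite !big_nil mulr0 le_eqVlt; apply/orP; left; rewrite cd_normsq_eq0.
rewrite !big_cons/= exprS.
have h := cd_normsq_ge0 (x - \sum_(x <- s) x).
have h1 : 1 <= 2 ^+ size s :> R by rewrite exprn_ege1// ler1n.
have h2 := cd_normsq_ge0 x.
move: h; rewrite !cd_normsqD cd_normsqN cd_dotNr => h.
move: IH h h1 h2.
move: (cd_normsq (\sum_(x <- s) x)) (\sum_(x <- s) cd_normsq x) (2 ^+ size s).
by move=> a b c; nra.
Qed.

Lemma mxnormsq_mulmx_le p n m (A : 'M[F]_(p, n)) : (k <= 3)%N ->
  exists2 C, 0 < C & forall Z : 'M[F]_(n, m), mxnormsq (cd_mulmx A Z) <= C * mxnormsq Z.
Proof.
(* The summand [1] keeps the constant positive when [A] is [0]. *)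
move=> k3; exists (1 + \sum_i 2 ^+ n * \sum_l cd_normsq (A i l)).
  rewrite ltr_pwDl// sumr_ge0// => i _; rewrite mulr_ge0 ?exprn_ge0// sumr_ge0//.
  by move=> l _; exact: cd_normsq_ge0.
move=> Z; rewrite mulrDl mul1r; apply: ler_wpDl; first exact: mxnormsq_ge0.
rewrite mulr_suml; apply: ler_sum => i _.
rewrite /mxnormsq exchange_big/= mulr_sumr; apply: ler_sum => j _.
rewrite mxE -(big_map (fun l => cd_mul (A i l) (Z l j)) xpredT id).
apply: le_trans (cd_normsq_sum_le _) _.
rewrite size_map -[X in 2 ^+ X]/(size (index_enum _)) big_map.
have -> : size (index_enum 'I_n) = n by rewrite -[RHS]card_ord cardE enumT.
rewrite -mulrA ler_wpM2l ?exprn_ge0// mulr_suml; apply: ler_sum => l _.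
rewrite cd_normsqM// ler_wpM2l ?cd_normsq_ge0// (bigD1 l)//= lerDl.
by apply: sumr_ge0 => h _; exact: cd_normsq_ge0.
Qed.

Lemma vol_mulmx_null p n m d (A : 'M[F]_(p, n)) (E : set 'M[F]_(n, m)) : (k <= 3)%N ->
  vol d E = 0%E -> vol d (cd_mulmx A @` E) = 0%E.
Proof.
move=> k3 E0; have [C C0 AC] := @mxnormsq_mulmx_le p n m A k3.
apply/eqP; rewrite eq_le hausdorff_ge0 ?andbT; last exact: mxdist_ge0.
apply: le_trans (@hausdorff_lipschitz _ _ _ _ _
  (@mxdist_ge0 _ _ _ _) (@mxdist_ge0 _ _ _ _)
  (cd_mulmx A) E (Num.sqrt C) d _ _) _.
- by rewrite sqrtr_gt0.
- move=> X Y _ _; rewrite !mxdistE -sqrtrM ?(ltW C0)// -cd_mulmxB.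
  by apply: ler_wsqrtr; exact: AC.
- by rewrite -/(vol d E) E0 mule0.
Qed.

End null_images.

Fixpoint cd_one (R : realType) (k : nat) : cd R k :=
  match k with 0 => (1 : R) | k'.+1 => (cd_one R k', 0) end.

Lemma cd_mul1 (R : realType) (k : nat) (x : cd R k) :
  cd_mul (cd_one R k) x = x /\ cd_mul x (cd_one R k) = x.
Proof.
elim: k x => [|k IH] x; first by split; [exact: mul1r|exact: mulr1].
have conj1 : cd_conj (cd_one R k) = cd_one R k.
  by elim: {IH x} k => //= k ->; rewrite oppr0.
have IHl y : cd_mul (cd_one R k) y = y by have [] := IH y.
have IHr y : cd_mul y (cd_one R k) = y by have [] := IH y.
split; apply: cd_eq; rewrite /= ?conj1 ?cd_conj0 ?cd_mul0l ?cd_mul0r ?IHl ?IHr//.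
- by rewrite subr0.
- by rewrite addr0.
- by rewrite subr0.
- by rewrite add0r.
Qed.

Theorem theorem2p1 (R : realType) (k : nat) (hk : (k <= 3)%N) (n m p : nat)
    (A : 'M[cd R k]_(p, n)) (hA : frakL n p n A)
    (E : set 'M[cd R k]_(n, m)) (hE : borel E)
    (hX : forall X, E X -> frakL m n n X)
    (hY : forall X, E X -> frakL m p n (cd_mulmx A X)) :
  let beta := (2 ^ k)%N in
  let d := (n * m * beta)%N in
  (vol d (cd_mulmx A @` E) =
     (\prod_(i < n) sigma A i ^+ (beta * m))%:E * vol d E)%E
  /\
  ((\prod_(i < n) sigma A i ^+ (beta * m))%:E * vol d E =
     (\prod_(i < n) lambda (cd_mulmx A (cd_adj A)) i
                      `^ ((beta * m)%:R / 2))%:E * vol d E)%E.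
Proof.
move=> beta d.
have s0 i : (i < n)%N -> 0 < sigma A i by exact: sigma_gt0.
(* Octonions with [n >= 2] are the one case in which no [svd] is constructed; there [E] and its
   image are null. *)
have [kn|] := boolP ((k <= 2) || (n <= 1))%N; last first.
  rewrite negb_or -!ltnNge => /andP[k2 n1].
  have k3 : k = 3 by apply/eqP; rewrite eqn_leq hk.
  subst k; have E0 : vol d E = 0%E by exact: octonion_null.
  by rewrite E0 !mule0; split=> //; exact: vol_mulmx_null.
have [U [V AUV]] : exists U V, svd m A U V.
  case/orP: kn => [k2|n1]; first exact: exists_svd_assoc.
  apply: exists_svd_col => //; exists (cd_one R k) => x.
  by have [] := cd_mul1 x.
split; first exact: vol_svd AUV s0 hE.
congr (_%:E * _)%E; apply: eq_bigr => i _.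
suff -> : lambda (cd_mulmx A (cd_adj A)) i = sigma A i ^+ 2.
  by rewrite powR_sqr_half// s0.
case/orP: kn => [k2|n1]; first exact: lambda_gram_assoc.
move: A hA i {AUV U V s0 hY hX hE E d}; move: n1.
case: n => [|[|//]] _ A hA i; first by case: i.
by rewrite (ord1 i) lambda_gram_col.
Qed.
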